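(* Suppose $\Lambda$ and $\Gamma$ are finite graphs and $A(\Lambda)$ embeds into $A(\Gamma)$. Let $\pi:A(\Gamma^e)\to A(\Gamma)$ be the natural retraction. (1) There is a homomorphism $\psi:A(\Lambda)\to A(\Gamma^e)$ such that $\phi=\pi\circ\psi:A(\Lambda)\to A(\Gamma)$ is an embedding and such that for each vertex $v$ of $\Lambda$, the set $\mathrm{supp}(\psi(v))$ induces a clique $K_v$ of $\Gamma^e$. (2) In (1), $\psi$ can be chosen so that $K_v\not\subseteq K_w$ for any two distinct vertices $v\neq w$ of $\Lambda$.
   Context: A graph is a (possibly infinite) simplicial 1-complex (no loops, no multi-edges). For a graph $\Gamma$ with vertex set $V(\Gamma)$ and edge set $E(\Gamma)$, the right-angled Artin group is $A(\Gamma)=\langle V(\Gamma)\mid [v,v']=1 \text{ for each } \{v,v'\}\in E(\Gamma)\rangle$. The extension graph $\Gamma^e$ is the graph whose vertices are the elements of $A(\Gamma)$ that are conjugate to vertices of $\Gamma$ (viewed as generators), two distinct vertices being adjacent if and only if they commute in $A(\Gamma)$. The natural retraction $\pi:A(\Gamma^e)\to A(\Gamma)$ is the homomorphism sending each generator of $A(\Gamma^e)$, i.e. each vertex of $\Gamma^e$ (a conjugate $w^{-1}vw\in A(\Gamma)$ of a vertex $v$ of $\Gamma$), to the element $w^{-1}vw$ of $A(\Gamma)$. For an element $g$ of a right-angled Artin group $A(X)$, $\mathrm{supp}(g)$ is the smallest set $U\subseteq V(X)$ such that each letter of a reduced (minimal length) word representing $g$ lies in $U\cup U^{-1}$. A clique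 is a complete subgraph. An embedding is an injective homomorphism. *)

(* Defs.v *)
From HB Require Import structures.
From mathcomp Require Import all_boot.
From mathcomp Require Import boolp classical_sets cardinality.

Set Implicit Arguments.
Unset Strict Implicit.
Unset Printing Implicit Defensive.

Local Open Scope quotient_scope.
Local Open Scope group_scope.

(* The vertex set may be infinite; [choiceType] is no restriction, since      *)
(* classically every type carries such a structure.                           *)
Record graph := Graph {
  vertex :> choiceType;
  adj : rel vertex;
  adj_sym : symmetric adj;
  adj_irr : irreflexive adj }.

Definition finite_graph (X : graph) : Prop := finite_set [set: X].

Definition clique (X : graph) (K : set X) : Prop :=
  forall x y : X, K x -> K y -> x <> y -> adj x y.

Section Raag.
Variable X : graph.

(* The letter (v, false) stands for v, and (v, true) for v^-1.                *)
Definition word := seq (X * bool).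

(* The congruence on words whose quotient is the group presented by           *)
(* < X | [v, w] = 1 for v adjacent to w >.                                    *)
Inductive raag_eq : word -> word -> Prop :=
| RaagRefl u : raag_eq u u
| RaagSym u v : raag_eq u v -> raag_eq v u
| RaagTrans u v w : raag_eq u v -> raag_eq v w -> raag_eq u w
| RaagCat u u' v v' :
    raag_eq u u' -> raag_eq v v' -> raag_eq (u ++ v) (u' ++ v')
| RaagCancel x b : raag_eq [:: (x, b); (x, ~~ b)] [::]
| RaagComm x y : adj x y ->
    raag_eq [:: (x, true); (y, true); (x, false); (y, false)] [::].

Definition raag_eqb (u v : word) : bool := `[< raag_eq u v >].

Lemma raag_eqb_refl : reflexive raag_eqb.
Proof. by move=> u; apply/asboolP; exact: RaagRefl. Qed.

Lemma raag_eqb_sym : symmetric raag_eqb.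
Proof. by move=> u v; apply/asboolP/asboolP; exact: RaagSym. Qed.

Lemma raag_eqb_trans : transitive raag_eqb.
Proof.
by move=> v u w /asboolP uv /asboolP vw; apply/asboolP; exact: RaagTrans uv vw.
Qed.

Canonical raag_equiv :=
  EquivRel raag_eqb raag_eqb_refl raag_eqb_sym raag_eqb_trans.

Definition raag : Type := {eq_quot raag_eqb}.

HB.instance Definition _ := Choice.on raag.
HB.instance Definition _ := EqQuotient.on raag.

Definition raag_class (w : word) : raag := \pi_raag w.

Lemma raag_classP u v : raag_class u = raag_class v <-> raag_eq u v.
Proof.
by split=> [/eqmodP/asboolP //|uv]; apply/eqmodP/asboolP.
Qed.

Lemma raag_class_repr g : raag_class (repr g) = g.
Proof. exact: reprK. Qed.

Definition winv (w : word) : word := rev [seq (l.1, ~~ l.2) | l <- w].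

Lemma winv_cat u v : winv (u ++ v) = winv v ++ winv u.
Proof. by rewrite /winv map_cat rev_cat. Qed.

Lemma winvK : involutive winv.
Proof.
move=> w; rewrite /winv map_rev revK -map_comp map_id_in // => -[x b] _ /=.
by rewrite negbK.
Qed.

Lemma raag_eq_winvl w : raag_eq (winv w ++ w) [::].
Proof.
elim: w => [|[x b] w IHw]; first exact: RaagRefl.
rewrite -cat1s winv_cat catA -(catA (winv w)).
apply: RaagTrans IHw; apply: RaagCat; last exact: RaagRefl.
rewrite -[X in raag_eq _ X]cats0; apply: RaagCat; first exact: RaagRefl.
by have := RaagCancel x (~~ b); rewrite negbK.
Qed.

Lemma raag_eq_winv u v : raag_eq u v -> raag_eq (winv u) (winv v).
Proof.
move=> uv.
have e1 : raag_eq (winv u ++ (v ++ winv v)) (winv u).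
  rewrite -[X in raag_eq _ X]cats0; apply: RaagCat; first exact: RaagRefl.
  by have := raag_eq_winvl (winv v); rewrite winvK.
apply: RaagTrans (RaagSym e1) _; rewrite catA.
rewrite -[X in raag_eq _ X]cat0s; apply: RaagCat; last exact: RaagRefl.
apply: RaagTrans (raag_eq_winvl u).
by apply: RaagCat; [exact: RaagRefl | exact: RaagSym].
Qed.

Definition raag_mul (g h : raag) := raag_class (repr g ++ repr h).
Definition raag_inv (g : raag) := raag_class (winv (repr g)).

Lemma raag_eq_repr w : raag_eq (repr (raag_class w)) w.
Proof. by apply/raag_classP; rewrite raag_class_repr. Qed.

Lemma raag_mulE u v :
  raag_mul (raag_class u) (raag_class v) = raag_class (u ++ v).
Proof. by apply/raag_classP/RaagCat; exact: raag_eq_repr. Qed.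

Lemma raag_invE u : raag_inv (raag_class u) = raag_class (winv u).
Proof. by apply/raag_classP/raag_eq_winv; exact: raag_eq_repr. Qed.

Lemma raag_mulA : associative raag_mul.
Proof.
move=> g h k; rewrite -(raag_class_repr g) -(raag_class_repr h).
by rewrite -(raag_class_repr k) !raag_mulE catA.
Qed.

Lemma raag_mul1 : left_id (raag_class [::]) raag_mul.
Proof. by move=> g; rewrite -(raag_class_repr g) raag_mulE. Qed.

Lemma raag_mulr1 : right_id (raag_class [::]) raag_mul.
Proof. by move=> g; rewrite -(raag_class_repr g) raag_mulE cats0. Qed.

Lemma raag_mulV : left_inverse (raag_class [::]) raag_inv raag_mul.
Proof.
move=> g; rewrite -(raag_class_repr g) raag_invE raag_mulE.
by apply/raag_classP; exact: raag_eq_winvl.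
Qed.

Lemma raag_mulrV : right_inverse (raag_class [::]) raag_inv raag_mul.
Proof.
move=> g; rewrite -(raag_class_repr g) raag_invE raag_mulE.
apply/raag_classP; rewrite -{1}[repr g]winvK; exact: raag_eq_winvl.
Qed.

HB.instance Definition _ := isGroup.Build raag
  raag_mulA raag_mul1 raag_mulr1 raag_mulV raag_mulrV.

Definition gen (x : X) : raag := raag_class [:: (x, false)].

Lemma raag_classM u v : raag_class (u ++ v) = raag_class u * raag_class v.
Proof. by rewrite -raag_mulE. Qed.

Lemma raag_class1 : raag_class [::] = 1.
Proof. by []. Qed.

Lemma gen_inv x : (gen x)^-1 = raag_class [:: (x, true)].
Proof. exact: raag_invE. Qed.

Lemma gen_commute x y : adj x y -> commute (gen x) (gen y).
Proof.
move=> xy; apply/commgP/eqP; rewrite /commg /conjg !gen_inv /gen.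
rewrite -(raag_classM [:: (x, false)]) -(raag_classM [:: (y, true)]).
rewrite -(raag_classM [:: (x, true)]) -raag_class1.
by apply/raag_classP; exact: RaagComm xy.
Qed.

Definition reduced (w : word) : Prop :=
  forall w', raag_class w' = raag_class w -> size w <= size w'.

(* A letter (v, b) lies in U or in U^-1 exactly when its vertex v lies in U.  *)
(* Quantifying over all reduced words for g avoids a choice: by Tits'         *)
(* solution of the word problem they all involve the same vertices.           *)
Definition supp (g : raag) : set X :=
  smallest (fun U : set X => forall w : word,
    raag_class w = g -> reduced w -> forall l, l \in w -> U l.1) set0.

Lemma suppE g : supp g = [set x | exists w : word,
  [/\ raag_class w = g, reduced w & exists b, (x, b) \in w]]%classic.
Proof.
apply/seteqP; split=> [x|x].
  by apply=> /=; split=> // w wg wr [y b] yw; exists w; split=> //; exists b.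
by move=> [w [wg wr [b xw]]] U [HU _]; exact: (HU w wg wr _ xw).
Qed.

End Raag.

Section Lift.
Variables (X : graph) (G : groupType) (f : X -> G).

Definition word_eval (w : word X) : G :=
  \prod_(l <- w) (if l.2 then (f l.1)^-1 else f l.1).

(* A homomorphism only when f maps adjacent vertices to commuting elements.   *)
Definition raag_lift (g : raag X) : G := word_eval (repr g).

Hypothesis fC : forall x y, adj x y -> commute (f x) (f y).

Lemma word_eval_eq u v : raag_eq u v -> word_eval u = word_eval v.
Proof.
rewrite /word_eval; elim=> {u v} //.
- by move=> u v w _ -> _ ->.
- by move=> u u' v v' _ eu _ ev; rewrite !big_cat /= eu ev.
- move=> x [] /=; rewrite !big_cons big_nil /= mulg1 ?mulVg //.
  by rewrite mulgV.
move=> x y /fC xy; rewrite !big_cons big_nil /= mulg1.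
by have /commgP/eqP := xy; rewrite /commg /conjg.
Qed.

Lemma raag_liftE w : raag_lift (raag_class w) = word_eval w.
Proof. by apply: word_eval_eq; exact: raag_eq_repr. Qed.

Lemma raag_lift_gen x : raag_lift (gen x) = f x.
Proof. by rewrite raag_liftE /word_eval big_seq1. Qed.

Lemma raag_liftM : {morph raag_lift : g h / g * h}.
Proof.
move=> g h; rewrite -(raag_class_repr g) -(raag_class_repr h) -raag_classM.
by rewrite !raag_liftE /word_eval big_cat.
Qed.

End Lift.

Section ExtensionGraph.
Variable X : graph.

(* In MathComp, g ^ w is the conjugate w^-1 * g * w.                          *)
Definition ext_vertex_pred (g : raag X) : bool :=
  `[< exists (x : X) (w : raag X), g = gen x ^ w >].

Definition ext_vertex : choiceType := {g : raag X | ext_vertex_pred g}.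

Definition ext_adj (a b : ext_vertex) : bool :=
  (a != b) && (val a * val b == val b * val a).

Lemma ext_adj_sym : symmetric ext_adj.
Proof. by move=> a b; rewrite /ext_adj eq_sym [_ * _ == _]eq_sym. Qed.

Lemma ext_adj_irr : irreflexive ext_adj.
Proof. by move=> a; rewrite /ext_adj eqxx. Qed.

Definition ext_graph : graph := Graph ext_adj_sym ext_adj_irr.

Definition retraction : raag ext_graph -> raag X :=
  @raag_lift ext_graph (raag X) (fun a : ext_vertex => val a).

Lemma ext_adj_commute (a b : ext_graph) :
  adj a b -> commute (val (a : ext_vertex)) (val (b : ext_vertex)).
Proof. by case/andP=> _ /eqP. Qed.

Lemma retraction_gen (a : ext_graph) :
  retraction (gen a) = val (a : ext_vertex).
Proof. exact: (raag_lift_gen ext_adj_commute). Qed.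

Lemma retractionM : {morph retraction : g h / g * h}.
Proof. exact: (raag_liftM ext_adj_commute). Qed.

HB.instance Definition _ :=
  isMultiplicative.Build (raag ext_graph) (raag X) retraction retractionM.

End ExtensionGraph.

(* Main.v *)
From HB Require Import structures.
Require Import Defs.
From mathcomp Require Import all_boot.
From mathcomp Require Import boolp classical_sets cardinality.
From mathcomp Require Import zify.

(* Every element of A(Gamma) is a product of commuting pure factors, i.e.     *)
(* conjugates of cyclically reduced elements whose support is not a join, and *)
(* whatever commutes with the element commutes with its pure factors. Hence a *)
(* power of a given embedding factors through A(Y), where Y is the            *)
(* commutation graph of the finitely many pure factors p of the images of the *)
(* vertices of Lambda, taken up to commensurability; vertices of Lambda go to *)
(* elements of A(Y) supported on cliques. Now replace each p by the vertex    *)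
(* p^-n b p^n of Gamma^e, where b is a conjugate of a vertex in the support   *)
(* of p. For suitable large exponents n, these vertices commute exactly when  *)
(* the corresponding pure factors do, because an element that commutes with   *)
(* two distant conjugates of b under powers of p commutes with p. High powers *)
(* of these vertices generate a copy of A(Y) by ping-pong: for two            *)
(* non-commuting vertices of Gamma^e, the exponents with which they can be    *)
(* split off from the left of an element cannot both be large.                *)
(* For the second part, minimise the total size of the cliques. If K_v is     *)
(* contained in K_w, then v commutes with all vertices adjacent to w, and     *)
(* the injective endomorphism w |-> w^m v^n of A(Lambda), for exponents m and *)
(* n that cancel a vertex of K_v, makes K_w smaller.                          *)

Set Implicit Arguments.
Unset Strict Implicit.
Unset Printing Implicit Defensive.

Local Open Scope group_scope.

(** * The word problem *)

(** Normal forms come first: words without a cancelling pair, even after shuffling, are unique up to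
    swaps of adjacent letters ([nf_raag]). Hence lengths, first letters and supports can be read
    off, and prefixes of reduced products can be compared ([exchange], [prefix_mul]). An element
    commuting with a cyclically reduced [c] is then a product of an element over [sup c] and one
    over its link ([commute_cyc]); cutting along joins gives the pure factors ([pure_dec]).

    Pure elements that commute without being commensurable live, up to a common conjugation, over a
    set and its link ([pure_commute_lk]). So commutation of pure factors depends only on
    commensurability classes ([sim_commute]), and a power of the given embedding passes through
    A(Y), where Y is the commutation graph of chosen representatives.

    Next, A(Y) is mapped to A(Gamma^e). Conjugating by high powers of a pure element destroys
    accidental commutation ([fill], [pure_vertex_avoid]), so Y can be placed in Gamma^e with
    adjacency preserved and reflected ([choose_exponents], [pvertex_adj]). High powers of these
    vertices satisfy the ping-pong conditions thanks to [behrstock], so their images in A(Gamma)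
    generate a copy of A(Y) ([pingpong], [realisation]).

    The composite A(Lambda) -> A(Y) -> A(Gamma^e) is the required map ([clique_embedding]). It even
    sends two adjacent vertices to elements with supports in a common clique, which is what lets
    [incomparable_cliques] remove inclusions by transvections. *)

Section WordProblem.
Variable X : graph.
Implicit Types (l m : X * bool) (u v w : word X).

Definition linv l : X * bool := (l.1, ~~ l.2).

Lemma linvK : involutive linv.
Proof. by case=> x b; rewrite /linv /= negbK. Qed.

Lemma linv_neq l : (linv l == l) = false.
Proof. by case: l => x []; apply/eqP. Qed.

Lemma adj_neq l m : adj l.1 m.1 -> (l == m) = false.
Proof. by apply: contraTF => /eqP ->; rewrite adj_irr. Qed.

(** Trace equivalence: adjacent letters may be swapped, but nothing is cancelled. *)
Inductive teq : word X -> word X -> Prop :=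
| TeqRefl w : teq w w
| TeqTrans u v w : teq u v -> teq v w -> teq u w
| TeqCons l u v : teq u v -> teq (l :: u) (l :: v)
| TeqSwap l m w : adj l.1 m.1 -> teq [:: l, m & w] [:: m, l & w].

Lemma teq_sym u v : teq u v -> teq v u.
Proof.
elim=> {u v}.
- by move=> w; exact: TeqRefl.
- by move=> u v w _ uv _ vw; exact: TeqTrans vw uv.
- by move=> l u v _; exact: TeqCons.
- by move=> l m w lm; apply: TeqSwap; rewrite adj_sym.
Qed.

Lemma teq_perm u v : teq u v -> perm_eq u v.
Proof.
elim=> {u v} //.
- by move=> u v w _ uv _; exact: perm_trans.
- by move=> l u v _ uv; rewrite perm_cons.
- by move=> l m w _; rewrite -(cat1s l) -(cat1s m) perm_catCA.
Qed.

(* [front l w] erases from [w] the first occurrence of [l], provided that     *)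
(* commutations can bring it to the front.                                    *)
Fixpoint front l w : option (word X) :=
  if w is m :: w' then
    if m == l then Some w'
    else if adj m.1 l.1 then omap (cons m) (front l w') else None
  else None.

Definition oteq (a b : option (word X)) : Prop :=
  match a, b with
  | Some u, Some v => teq u v
  | None, None => True
  | _, _ => False
  end.

Lemma oteq_refl a : oteq a a.
Proof. by case: a => //= w; exact: TeqRefl. Qed.

Lemma oteq_trans a b c : oteq a b -> oteq b c -> oteq a c.
Proof. by case: a b c => [u|] [v|] [w|] //=; exact: TeqTrans. Qed.

Lemma front_teq l u v : teq u v -> oteq (front l u) (front l v).
Proof.
elim=> {u v} /=.
- by move=> w; exact: oteq_refl.
- by move=> u v w _ uv _ vw; exact: oteq_trans uv vw.
- move=> m u v uv; case: (m == l) => //; case: (adj m.1 l.1) => //.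
  by case: (front l u) (front l v) => [u'|] [v'|] //=; exact: TeqCons.
move=> m k w mk; have mkF := adj_neq mk.
case: (eqVneq m l) => [ml|_].
  by subst m; rewrite eq_sym mkF -[adj k.1 l.1]adj_sym mk /=; exact: TeqRefl.
case: (eqVneq k l) => [kl|_]; first by rewrite -kl mk /=; exact: TeqRefl.
case ml: (adj m.1 l.1); case kl: (adj k.1 l.1) => //=.
by case: (front l w) => //= w'; exact: TeqSwap.
Qed.

Lemma front_Some l w w' : front l w = Some w' -> teq w (l :: w').
Proof.
elim: w w' => //= m w IH w'; case: eqVneq => [-> [->]|_]; first exact: TeqRefl.
case ml: (adj _ _) => //; case E: (front l w) => [u|] //= [<-].
by apply: TeqTrans (TeqCons m (IH _ E)) _; exact: TeqSwap.
Qed.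

Lemma front_cons l w : front l (l :: w) = Some w.
Proof. by rewrite /= eqxx. Qed.

Lemma front_adj l m w : adj m.1 l.1 -> front l (m :: w) = omap (cons m) (front l w).
Proof. by move=> ml /=; rewrite (adj_neq ml) ml. Qed.

(* The action of a letter on the normal forms, i.e. on trace classes of words *)
(* without a cancelling pair.                                                 *)
Definition act l w := if front (linv l) w is Some w' then w' else l :: w.

Fixpoint nored w : bool :=
  if w is l :: w' then nored w' && ~~ front (linv l) w' else true.

Lemma nored_teq u v : teq u v -> nored u = nored v.
Proof.
elim=> {u v} //=.
- by move=> u v w _ -> _ ->.
- move=> l u v uv ->; congr (_ && ~~ _).
  by have := front_teq (linv l) uv; case: (front _ u) (front _ v) => [?|] [?|].
move=> l m w lm; have ml : adj m.1 l.1 by rewrite adj_sym.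
have n1 : (m == linv l) = false.
  by apply: contraTF ml => /eqP ->; rewrite adj_irr.
have n2 : (l == linv m) = false.
  by apply: contraTF ml => /eqP ->; rewrite adj_irr.
rewrite n1 n2 lm ml; case: (front _ w) (front _ w) => [?|] [?|] //=;
  by rewrite ?andbF ?andbT.
Qed.

Lemma act_teq l u v : teq u v -> teq (act l u) (act l v).
Proof.
move=> uv; rewrite /act; have := front_teq (linv l) uv.
by case: (front _ u) (front _ v) => [?|] [?|] //= _; exact: TeqCons.
Qed.

Lemma act_nored l w : nored w -> nored (act l w).
Proof.
move=> rw; rewrite /act; case E: (front _ w) => [w'|] /=; last by rewrite rw E.
by move: rw; rewrite (nored_teq (front_Some E)) => /andP[].
Qed.

Lemma act_linvK l w : nored w -> teq (act l (act (linv l) w)) w.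
Proof.
move=> rw; rewrite {2}/act linvK; case E: (front l w) => [w'|].
  have e := front_Some E; move: rw; rewrite (nored_teq e) => /andP[_].
  by rewrite /act; case: (front _ w') => // _; exact: teq_sym.
by rewrite /act front_cons; exact: TeqRefl.
Qed.

Lemma actC l m w : adj l.1 m.1 -> nored w ->
  teq (act l (act m w)) (act m (act l w)).
Proof.
move=> lm rw; have ml : adj m.1 l.1 by rewrite adj_sym.
have key a b u : adj a.1 b.1 -> front (linv a) (b :: u) = omap (cons b) (front (linv a) u).
  by move=> ab; apply: front_adj; rewrite adj_sym.
rewrite {2 4}/act.
case Em: (front (linv m) w) => [w1|]; case El: (front (linv l) w) => [w2|].
- have e1 := front_Some Em; have := front_teq (linv l) e1.
  rewrite El front_adj; last by rewrite adj_sym.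
  case F1: (front _ w1) => [w3|] //= e2.
  rewrite {1}/act F1; have := front_teq (linv m) e2.
  by rewrite front_cons /act; case: (front _ w2) => //= ? /teq_sym.
- have e1 := front_Some Em; have := front_teq (linv l) e1.
  rewrite El front_adj; last by rewrite adj_sym.
  case F1: (front _ w1) => [w3|] //= _.
  by rewrite /act F1 key // Em /=; exact: TeqRefl.
- have e1 := front_Some El; have := front_teq (linv m) e1.
  rewrite Em front_adj //.
  case F1: (front _ w2) => [w3|] //= _.
  by rewrite /act F1 key // El /=; exact: TeqRefl.
by rewrite /act !key // Em El /=; exact: TeqSwap.
Qed.

Definition nf w := foldr act [::] w.

Lemma nored_foldr u w : nored w -> nored (foldr act w u).
Proof. by move=> rw; elim: u => //= l u IH; exact: act_nored. Qed.

Lemma nored_nf w : nored (nf w).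
Proof. exact: nored_foldr. Qed.

Lemma foldr_act_teq u v w : teq v w -> teq (foldr act v u) (foldr act w u).
Proof. by move=> vw; elim: u => //= l u IH; exact: act_teq. Qed.

(** Van der Waerden's trick: the letters act on trace classes of words without cancelling pairs, and
    [act_linvK] and [actC] say that this action respects the defining relations. Letting a word act
    on [[::]] therefore gives an invariant of the group element. *)
Lemma foldr_act_raag u v w :
  raag_eq u v -> nored w -> teq (foldr act w u) (foldr act w v).
Proof.
move=> uv; elim: uv w => {u v}.
- by move=> *; exact: TeqRefl.
- by move=> u v _ IH w rw; exact/teq_sym/IH.
- by move=> u v w' _ IH1 _ IH2 w rw; exact: TeqTrans (IH1 w rw) (IH2 w rw).
- move=> u u' v v' _ IHu _ IHv w rw; rewrite !foldr_cat.
  apply: TeqTrans (IHu _ (nored_foldr v rw)) _.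
  exact: foldr_act_teq (IHv w rw).
- move=> x b w rw /=.
  by have := act_linvK (x, b) rw; rewrite /linv.
move=> x y xy w rw /=.
have c1 := actC (l := (x, false)) (m := (y, false)) xy rw.
apply: TeqTrans (act_teq _ (act_teq _ c1)) _.
have r1 : nored (act (x, false) w) by exact: act_nored.
apply: TeqTrans (act_teq _ (act_linvK (y, true) r1)) _.
exact: (act_linvK (x, true) rw).
Qed.

Lemma nf_raag u v : raag_eq u v -> teq (nf u) (nf v).
Proof. by move=> uv; exact: foldr_act_raag. Qed.

Lemma nf_id w : nored w -> nf w = w.
Proof.
by elim: w => //= l w IH /andP[/IH -> nl]; rewrite /act; case: (front _ w) nl.
Qed.

Lemma teq_raag u v : teq u v -> raag_eq u v.
Proof.
elim=> {u v}.
- exact: RaagRefl.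
- by move=> u v w _ uv _; exact: RaagTrans.
- by move=> l u v _ uv; exact: (RaagCat (RaagRefl [:: l]) uv).
move=> [x b] [y c] w /= xy.
apply: (@RaagCat _ [:: _; _] [:: _; _] w w); last exact: RaagRefl.
have cxy := gen_commute xy.
have gE z d : raag_class [:: (z, d)] = if d then (gen z)^-1 else gen z :> raag X.
  by case: d; rewrite ?gen_inv.
apply/raag_classP; rewrite (raag_classM [:: _] [:: _]) [RHS](raag_classM [:: _] [:: _]) !gE.
have cV (g h : raag X) d : commute g h -> commute g (if d then h^-1 else h).
  by case: d => //; exact: commuteV.
exact/cV/commute_sym/cV/commute_sym.
Qed.

Lemma raag_eq_nf w : raag_eq w (nf w).
Proof.
elim: w => [|l w IH] /=; first exact: RaagRefl.
apply: RaagTrans (_ : raag_eq (l :: nf w) _).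
  exact: (RaagCat (RaagRefl [:: l]) IH).
rewrite /act; case E: (front _ _) => [w'|]; last exact: RaagRefl.
have e := teq_raag (front_Some E).
apply: RaagTrans (_ : raag_eq ([:: l; linv l] ++ w') _).
  exact: (RaagCat (RaagRefl [:: l]) e).
rewrite -[X in raag_eq _ X]cat0s; apply: RaagCat; last exact: RaagRefl.
by case: (l) => x b; exact: RaagCancel.
Qed.

Lemma size_act l w : size (act l w) <= (size w).+1.
Proof.
rewrite /act; case E: (front _ w) => [w'|] //.
by rewrite (perm_size (teq_perm (front_Some E))) /= ltnW.
Qed.

Lemma size_nf w : size (nf w) <= size w.
Proof. by elim: w => //= l w IH; apply: leq_trans (size_act _ _) _. Qed.

End WordProblem.

(** * Length, first letters and supports *)

(* The various canonical paths to the group operations of [raag X] are not    *)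
(* syntactically equal, which [lia] cannot see.                               *)
Definition rmul (X : graph) (g h : raag X) : raag X := g * h.
Definition rinv (X : graph) (g : raag X) : raag X := g^-1.

Ltac rlia :=
  repeat match goal with
  | |- context [@mul ?S ?g ?h] => change (@mul S g h) with (rmul g h)
  | |- context [@inv ?S ?g] => change (@inv S g) with (rinv g)
  | H : context [@mul ?S ?g ?h] |- _ => change (@mul S g h) with (rmul g h) in H
  | H : context [@inv ?S ?g] |- _ => change (@inv S g) with (rinv g) in H
  end; lia.

Section Length.
Variable X : graph.
Implicit Types (l m : X * bool) (w : word X) (g h k : raag X) (x y : X).

Definition gl l : raag X := raag_class [:: l].
Definition nfg g := nf (repr g).
Definition len g := size (nfg g).
(* Some reduced word for [g] begins with the letter [l]. *)
Definition starts l g : bool := front l (nfg g).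
Definition cnt x g := count (fun l => l.1 == x) (nfg g).

Lemma glV l : (gl l)^-1 = gl (linv l).
Proof. exact: raag_invE. Qed.

Lemma gl_cons l w : raag_class (l :: w) = gl l * raag_class w.
Proof. exact: (raag_classM [:: l] w). Qed.

Lemma nored_nfg g : nored (nfg g).
Proof. exact: nored_nf. Qed.

Lemma nfgK g : raag_class (nfg g) = g.
Proof.
by rewrite -[RHS]raag_class_repr; apply/raag_classP/RaagSym/raag_eq_nf.
Qed.

Lemma nfg_class w : teq (nfg (raag_class w)) (nf w).
Proof. exact/nf_raag/raag_eq_repr. Qed.

Lemma nfg_nored w : nored w -> teq (nfg (raag_class w)) w.
Proof. by move=> rw; rewrite -[X in teq _ X]nf_id //; exact: nfg_class. Qed.

Lemma nfg_gl l g : teq (nfg (gl l * g)) (act l (nfg g)).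
Proof.
rewrite -[in X in teq X _](nfgK g) -gl_cons.
by have := nfg_class (l :: nfg g); rewrite /= (nf_id (nored_nfg g)).
Qed.

Lemma starts_teq l w g : teq (nfg g) w -> starts l g = front l w :> bool.
Proof. by move/(front_teq l); rewrite /starts; case: (front _ _) (front _ _) => [?|] [?|]. Qed.

Lemma len_teq w g : teq (nfg g) w -> len g = size w.
Proof. by move/teq_perm/perm_size. Qed.

Lemma cnt_teq x w g : teq (nfg g) w -> cnt x g = count (fun l => l.1 == x) w.
Proof. by move/teq_perm/permP; exact. Qed.

Lemma nstarts_nfg l g : ~~ starts (linv l) g -> teq (nfg (gl l * g)) (l :: nfg g).
Proof. by have := nfg_gl l g; rewrite /starts /act; case: (front _ _). Qed.

Lemma len_gl l g : ~~ starts (linv l) g -> len (gl l * g) = (len g).+1.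
Proof. by move/nstarts_nfg/len_teq. Qed.

Lemma cnt_gl x l g : ~~ starts (linv l) g -> cnt x (gl l * g) = (l.1 == x) + cnt x g.
Proof. by move/nstarts_nfg/cnt_teq ->. Qed.

Lemma starts_gl l g : starts l (gl l * g) = ~~ starts (linv l) g.
Proof.
case E: (starts (linv l) g) => /=; last first.
  by rewrite (starts_teq l (nstarts_nfg (negbT E))) front_cons.
rewrite (starts_teq l (nfg_gl l g)) /act; move: E; rewrite /starts.
case E: (front _ _) => [w|] // _.
have := nored_nfg g; rewrite (nored_teq (front_Some E)) /= linvK => /andP[_].
by case: (front _ _).
Qed.

Lemma starts_glK l g : starts l g -> ~~ starts (linv l) (gl (linv l) * g).
Proof. by rewrite starts_gl linvK => ->. Qed.

Lemma glK l g : gl l * (gl (linv l) * g) = g.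
Proof. by rewrite -glV mulVKg. Qed.

Lemma glVK l g : gl (linv l) * (gl l * g) = g.
Proof. by rewrite -glV mulKg. Qed.

Lemma startsP l g :
  starts l g -> exists2 h, g = gl l * h & ~~ starts (linv l) h.
Proof. by exists (gl (linv l) * g); rewrite ?glK ?starts_glK. Qed.

Lemma starts_len l g : starts l g -> len g = (len (gl (linv l) * g)).+1.
Proof. by case/startsP => h -> nh; rewrite glVK len_gl. Qed.

Lemma exchange l m g : starts l g -> starts m g -> l != m ->
  adj l.1 m.1 /\ starts m (gl (linv l) * g).
Proof.
case/startsP => h -> nh; rewrite glVK (starts_teq m (nstarts_nfg nh)) /=.
by case: eqVneq => // _; case: (adj l.1 m.1) => //; rewrite /starts; case: front.
Qed.

Lemma starts_adj l m g : adj l.1 m.1 -> starts l (gl m * g) = starts l g.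
Proof.
move=> lm; have ml : adj m.1 l.1 by rewrite adj_sym.
rewrite (starts_teq l (nfg_gl m g)) /act; case E: (front (linv m) _) => [w|].
  rewrite /starts; have := front_teq l (front_Some E).
  rewrite front_adj //.
  by case: (front l (nfg g)) => [?|]; case: (front l w).
by rewrite front_adj // /starts; case: front.
Qed.

Lemma raag_ind (P : raag X -> Prop) :
  P 1 -> (forall l g, ~~ starts (linv l) g -> P g -> P (gl l * g)) ->
  forall g, P g.
Proof.
move=> P1 Pl g; rewrite -(nfgK g); elim: (nfg g) (nored_nfg g) => //= l w IH.
move=> /andP[rw nl]; rewrite gl_cons; apply: Pl; last exact: IH.
by rewrite (starts_teq _ (nfg_nored rw)).
Qed.

Lemma len1 : len 1 = 0.
Proof. exact: len_teq (nfg_nored (w := [::]) isT). Qed.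

Lemma cnt1 x : cnt x 1 = 0.
Proof. by rewrite (cnt_teq x (nfg_nored (w := [::]) isT)). Qed.

Lemma starts1 l : starts l 1 = false.
Proof. by rewrite (starts_teq l (nfg_nored (w := [::]) isT)). Qed.

Lemma len_eq0 g : len g = 0 -> g = 1.
Proof. by rewrite -{2}(nfgK g) /len; case: (nfg g). Qed.

Lemma cnt_eq0 g : (forall x, cnt x g = 0) -> g = 1.
Proof.
rewrite -{2}(nfgK g) /cnt; case: (nfg g) => // l w /(_ l.1).
by rewrite /= eqxx.
Qed.

Lemma starts_neq1 g : g <> 1 -> exists l, starts l g.
Proof.
elim/raag_ind: g => [//|l g ng _ _]; exists l; by rewrite starts_gl.
Qed.

Lemma nf_size_nored w : size (nf w) = size w -> nored w.
Proof.
elim: w => //= l w IH; rewrite /act.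
have := size_nf w; case E: (front _ _) => [w'|] /=.
  by have := perm_size (teq_perm (front_Some E)) => /=; rlia.
move=> _ [/IH rw]; rewrite rw /=.
by move: E; rewrite nf_id // => ->.
Qed.

Lemma len_class w : len (raag_class w) = size (nf w).
Proof. exact: len_teq (nfg_class w). Qed.

Lemma len_class_le w : len (raag_class w) <= size w.
Proof. by rewrite len_class size_nf. Qed.

Lemma count_nf_le (p : pred (X * bool)) w : count p (nf w) <= count p w.
Proof.
elim: w => //= l w IH; rewrite /act; case E: (front _ _) => [w'|] /=.
  by have /= := permP (teq_perm (front_Some E)) p; rlia.
by rlia.
Qed.

Lemma cnt_class_le x w : cnt x (raag_class w) <= count (fun l => l.1 == x) w.
Proof. by rewrite (cnt_teq x (nfg_class w)) count_nf_le. Qed.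

Lemma mul_class g h : g * h = raag_class (nfg g ++ nfg h).
Proof. by rewrite raag_classM !nfgK. Qed.

Lemma inv_class g : g^-1 = raag_class (winv (nfg g)).
Proof. by rewrite -{1}(nfgK g); exact: raag_invE. Qed.

Lemma lenM g h : len (g * h) <= len g + len h.
Proof. by rewrite mul_class (leq_trans (len_class_le _)) // size_cat. Qed.

Lemma cntM x g h : cnt x (g * h) <= cnt x g + cnt x h.
Proof. by rewrite mul_class (leq_trans (cnt_class_le _ _)) // count_cat. Qed.

Lemma lenV g : len g^-1 = len g.
Proof.
have le h : len h^-1 <= len h.
  by rewrite inv_class (leq_trans (len_class_le _)) // size_rev size_map.
by apply/eqP; rewrite eqn_leq le -{1}(invgK g) le.
Qed.

Lemma cntV x g : cnt x g^-1 = cnt x g.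
Proof.
have le h : cnt x h^-1 <= cnt x h.
  rewrite inv_class (leq_trans (cnt_class_le _ _)) // count_rev count_map.
  by apply: eq_leq; exact: eq_count.
by apply/eqP; rewrite eqn_leq le -{1}(invgK g) le.
Qed.

Lemma lenX g n : len (g ^+ n) <= (n * len g)%N.
Proof.
by elim: n => [|n IH]; rewrite ?len1 // expgS (leq_trans (lenM _ _)) // mulSn leq_add2l.
Qed.

Lemma conjE g h : g ^ h = h^-1 * (g * h).
Proof. by []. Qed.

Lemma len_conj g h : len (g ^ h) <= len g + (2 * len h)%N.
Proof.
by rewrite conjE (leq_trans (lenM _ _)) // lenV; have := lenM g h; rlia.
Qed.

(* No cancellation occurs in the product of [g] and [h]. *)
Definition rp g h := len (g * h) = len g + len h.

Lemma rp_nored g h : rp g h -> nored (nfg g ++ nfg h).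
Proof.
rewrite /rp mul_class len_class => e; apply: nf_size_nored.
by rewrite e size_cat.
Qed.

Lemma cnt_rp x g h : rp g h -> cnt x (g * h) = cnt x g + cnt x h.
Proof.
by move/rp_nored/nfg_nored/cnt_teq; rewrite -mul_class => ->; rewrite count_cat.
Qed.

Lemma rpA g h k : rp g h -> rp (g * h) k -> rp h k /\ rp g (h * k).
Proof.
rewrite /rp => e1 e2; have := lenM h k; have := lenM g (h * k).
by rewrite mulgA; rlia.
Qed.

Lemma rpA' g h k : rp h k -> rp g (h * k) -> rp g h /\ rp (g * h) k.
Proof.
rewrite /rp => e1 e2; have := lenM g h; have := lenM (g * h) k.
by rewrite -mulgA; rlia.
Qed.

Lemma rpV g h : rp g h -> rp h^-1 g^-1.
Proof. by rewrite /rp -invgM !lenV addnC. Qed.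

Lemma rp1 g : rp g 1.
Proof. by rewrite /rp mulg1 len1 addn0. Qed.

Lemma rp1g g : rp 1 g.
Proof. by rewrite /rp mul1g len1. Qed.

Lemma len_gl1 l : len (gl l) = 1%N.
Proof. by rewrite -[gl l]mulg1 len_gl ?starts1 // len1. Qed.

Lemma starts_gl1 m l : starts m (gl l) = (l == m).
Proof.
rewrite (starts_teq m (nfg_nored (w := [:: l]) isT)) /=.
by case: (l == m) => //; case: ifP.
Qed.

Lemma rp_glE l g : rp (gl l) g <-> ~~ starts (linv l) g.
Proof.
split=> [|/len_gl e]; last by rewrite /rp e len_gl1.
rewrite /rp len_gl1; apply: contraPN => /starts_len; rewrite linvK; rlia.
Qed.

Lemma starts_rp l g h : rp g h -> starts l g -> starts l (g * h).
Proof.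
move=> + /startsP[k ek nk]; subst g => rgh.
have rlk : rp (gl l) k by exact/rp_glE.
have [_ ] := rpA rlk rgh.
by rewrite -mulgA starts_gl => /rp_glE.
Qed.

(* [g] lies in the subgroup generated by [S]. *)
Definition inA (S : X -> Prop) g := forall x, 0 < cnt x g -> S x.

Lemma inAM (S : X -> Prop) g h : inA S g -> inA S h -> inA S (g * h).
Proof.
move=> Sg Sh x; have := cntM x g h => le lt.
by have [/Sg//|] := ltnP 0 (cnt x g) => ?; apply: Sh; rlia.
Qed.

Lemma inAV (S : X -> Prop) g : inA S g -> inA S g^-1.
Proof. by move=> Sg x; rewrite cntV; exact: Sg. Qed.

Lemma inA1 (S : X -> Prop) : inA S 1.
Proof. by move=> x; rewrite cnt1. Qed.

Lemma inAX (S : X -> Prop) g n : inA S g -> inA S (g ^+ n).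
Proof.
by move=> Sg; elim: n => [|n IH]; [exact: inA1 | rewrite expgS; exact: inAM].
Qed.

Lemma inAJ (S : X -> Prop) g h : inA S g -> inA S h -> inA S (g ^ h).
Proof. by move=> Sg Sh; apply: inAM; [exact: inAV | exact: inAM]. Qed.

Lemma inA_sub (S T : X -> Prop) g : (forall x, S x -> T x) -> inA S g -> inA T g.
Proof. by move=> ST Sg x /Sg/ST. Qed.

Lemma inA_rp (S : X -> Prop) g h : rp g h -> inA S (g * h) -> inA S g /\ inA S h.
Proof. by move=> r Sgh; split=> x lt; apply: Sgh; rewrite cnt_rp //; rlia. Qed.

Lemma cnt_gl1 x l : cnt x (gl l) = (l.1 == x) :> nat.
Proof. by rewrite -[gl l]mulg1 cnt_gl ?starts1 // cnt1 addn0. Qed.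

Lemma inA_gl (S : X -> Prop) l : inA S (gl l) <-> S l.1.
Proof.
split=> [|Sl x]; first by apply; rewrite cnt_gl1 eqxx.
by rewrite cnt_gl1; case: eqVneq => [<-|].
Qed.

Lemma inA_glM (S : X -> Prop) l g : ~~ starts (linv l) g ->
  inA S (gl l * g) <-> S l.1 /\ inA S g.
Proof.
move=> ng; split=> [|[Sl Sg]]; last by apply: inAM => //; exact/inA_gl.
by move/rp_glE: ng => ng /(inA_rp ng)[/inA_gl].
Qed.

Lemma starts_cnt l g : starts l g -> 0 < cnt l.1 g.
Proof. by case/startsP => h -> nh; rewrite cnt_gl // eqxx. Qed.

Lemma inA_starts (S : X -> Prop) l g : inA S g -> starts l g -> S l.1.
Proof. by move=> Sg /starts_cnt; exact: Sg. Qed.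

Lemma gl_commute l m : adj l.1 m.1 -> commute (gl l) (gl m).
Proof.
move=> lm; rewrite /commute /gl -(raag_classM [:: l]) -(raag_classM [:: m]).
exact/raag_classP/teq_raag/TeqSwap.
Qed.

Lemma commute_inA (S T : X -> Prop) g h :
  (forall x y, S x -> T y -> adj x y) -> inA S g -> inA T h -> commute g h.
Proof.
move=> ST; elim/raag_ind: g => [*|l g ng IH /inA_glM].
  exact/commute_sym/commute1.
case=> // Sl Sg Th; apply/commute_sym/commuteM; last exact/commute_sym/IH.
elim/raag_ind: h Th {IH} => [*|m h nh IH /inA_glM]; first exact/commute_sym/commute1.
case=> // Tm Th; apply/commute_sym/commuteM; last exact/commute_sym/IH.
exact/gl_commute/ST.
Qed.

Lemma starts_inA_adj l g h : inA (adj l.1) g -> starts l (g * h) = starts l h.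
Proof.
elim/raag_ind: g => [|m g ng IH]; first by rewrite mul1g.
by case/inA_glM => // lm Sg; rewrite -mulgA starts_adj // IH.
Qed.

Lemma starts_mul l g h : rp g h ->
  starts l (g * h) <-> starts l g \/ starts l h /\ inA (adj l.1) g.
Proof.
move=> rgh; split; last first.
  by case=> [|[sh Sg]]; [exact: starts_rp | rewrite starts_inA_adj].
elim/raag_ind: g rgh => [_|m g /[dup] ng /rp_glE rmg IH rgh].
  by rewrite mul1g; right; split=> //; exact: inA1.
have [rgh' /rp_glE ngh] := rpA rmg rgh.
have [->|lm] := eqVneq l m; first by left; rewrite starts_gl.
rewrite -mulgA => sl.
have sm : starts m (gl m * (g * h)) by rewrite starts_gl.
have [|ml] := exchange sm sl; first by rewrite eq_sym.
rewrite glVK => /(IH rgh')[sg|[sh Sg]].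
  by left; rewrite starts_adj // adj_sym.
by right; split=> //; apply/inA_glM => //; rewrite adj_sym.
Qed.

Lemma rp_criterion g h :
  (forall l, starts l h -> ~~ starts l g^-1) -> rp g h.
Proof.
elim/raag_ind: g => [_|m g /[dup] ng /rp_glE rmg IH H]; first exact: rp1g.
have rgm := rpV rmg; rewrite glV in rgm.
have rgh : rp g h.
  apply: IH => l /H; apply: contra => sl.
  by rewrite invgM glV; exact: starts_rp.
have [//|] := boolP (starts (linv m) (g * h)).
  case/(starts_mul _ rgh) => [sm|[sh Sg]]; first by rewrite sm in ng.
  case/negP: (H _ sh); rewrite invgM glV starts_inA_adj; last exact: inAV.
  by rewrite -[gl _]mulg1 starts_gl linvK starts1.
by move/rp_glE => r; have [] := rpA' rgh r.
Qed.

(** Stripping first letters in [S] as long as possible leaves the shortest element [t] of the coset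
    of [g]. *)
Lemma coset_dec (S : X -> Prop) g : exists s t,
  [/\ g = s * t, rp s t, inA S s & forall l, starts l t -> ~ S l.1].
Proof.
have [n] := ubnP (len g); elim: n g => // n IH g.
have [[l [sl Sl]]|H] := pselect (exists l, starts l g /\ S l.1); last first.
  exists 1, g; split; [by rewrite mul1g|exact: rp1g|exact: inA1|].
  by move=> l sl Sl; apply: H; exists l.
case/startsP: sl => h -> /[dup] nh /rp_glE rlh; rewrite len_gl // ltnS => lt.
have [s [t [e r Ss Ht]]] := IH h lt.
subst h; exists (gl l * s), t; split => //; first by rewrite mulgA.
- by have [] := rpA' r rlh.
- by apply: inAM => //; exact/inA_gl.
Qed.

Lemma inA_split (S T : X -> Prop) g :
  (forall x y, S x -> T y -> adj x y) -> inA (fun x => S x \/ T x) g ->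
  exists s t, [/\ g = s * t, inA S s & inA T t].
Proof.
move=> ST; elim/raag_ind: g => [_|l g ng IH /inA_glM].
  by exists 1, 1; rewrite mulg1; split=> //; exact: inA1.
case=> // Hl /IH[s [t [-> Ss Tt]]]; case: Hl => Hl.
  exists (gl l * s), t; rewrite mulgA; split=> //.
  by apply: inAM => //; exact/inA_gl.
exists s, (gl l * t); rewrite !mulgA; split=> //; last by apply: inAM => //; exact/inA_gl.
congr (_ * _); apply/commute_sym/(commute_inA ST) => //; exact/inA_gl.
Qed.

(** Levi's lemma for traces: a prefix of [g * h] takes a prefix [s1] from [g] and a prefix [s2] from
    [h], and [s2] can only be reached by passing every letter of the remainder [g1]. *)
Lemma prefix_mul g h s z : rp g h -> g * h = s * z -> rp s z ->
  exists s1 s2 g1 h1, [/\ s = s1 * s2, g = s1 * g1, h = s2 * h1 &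
    [/\ rp s1 s2, rp s1 g1, rp s2 h1 &
        forall x y, 0 < cnt x s2 -> 0 < cnt y g1 -> adj x y]].
Proof.
elim/raag_ind: s g h z => [|l s /[dup] ns /rp_glE rls IH] g h z rgh e rsz.
  exists 1, 1, g, h; rewrite !mul1g; split=> //; split; rewrite ?len1 //;
    try exact: rp1g; by move=> x y; rewrite cnt1.
have [rsz' rlsz] := rpA rls rsz.
have : starts l (g * h) by rewrite e; apply: starts_rp => //; rewrite starts_gl.
case/(starts_mul _ rgh) => [/startsP[g' ? /[dup] ng' /rp_glE rlg]|[]].
  subst g; have [rgh' _] := rpA rlg rgh.
  have e' : g' * h = s * z by apply: (mulgI (gl l)); rewrite !mulgA.
  have [s1 [s2 [g1 [h1 [? ? ? [r1 r2 r3 H]]]]]] := IH _ _ _ rgh' e' rsz'; subst.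
  have [rls1 rl1] := rpA' r2 rlg.
  exists (gl l * s1), s2, g1, h1; rewrite !mulgA; split=> //; split=> //.
  by have [] := rpA' r1 rls.
case/startsP=> h' ? /[dup] nh' /rp_glE rlh Sg; subst h.
have clg : commute (gl l) g.
  by apply: (commute_inA (S := fun x => x = l.1) (T := adj l.1)) => //;
     [move=> x y -> | exact/inA_gl].
have e' : g * h' = s * z.
  by apply: (mulgI (gl l)); rewrite !mulgA clg -e mulgA.
have rgh' : rp g h'.
  have := len_gl nh'; have := lenM g h'; move: rgh.
  rewrite /rp mulgA -clg -mulgA => r1 r2 r3.
  by have := lenM (gl l) (g * h'); rewrite len_gl1; rlia.
have [s1 [s2 [g1 [h1 [? ? ? [r1 r2 r3 H]]]]]] := IH _ _ _ rgh' e' rsz'; subst.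
have [Sl1 Sl2] := inA_rp r2 Sg.
have cls1 : commute (gl l) s1.
  by apply: (commute_inA (S := fun x => x = l.1) (T := adj l.1)) => //;
     [move=> x y -> | exact/inA_gl].
have [_ rl] := rpA' r1 rls.
have [rls2 rl2] := rpA' r3 rlh.
exists s1, (gl l * s2), g1, h1; rewrite !mulgA cls1; split=> //; split=> //.
  move: r1 rl (len_gl1 l) rls2; rewrite /rp mulgA -cls1 -mulgA => r1 rl ll r2'.
  move: rls; rewrite /rp ll r1 r2' ll mulgA; rlia.
move=> x y; move/rp_glE: (rls2) => nn; rewrite cnt_gl // addn_gt0 => /orP[|xs ys].
  by rewrite lt0b => /eqP <-; exact: Sl2.
exact: H.
Qed.

End Length.

(** * Retractions and cyclically reduced elements *)

Section Cyclic.
Variable X : graph.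
Implicit Types (l m : X * bool) (w : word X) (c g h k y z : raag X) (x : X).
Implicit Types (S T : X -> Prop).

Definition sup g x : Prop := 0 < cnt x g.
Definition lk S x : Prop := forall x', S x' -> adj x x'.

Lemma inA_sup g : inA (sup g) g.
Proof. by []. Qed.

Lemma lk_adj S x x' : S x -> lk S x' -> adj x x'.
Proof. by move=> Sx /(_ x Sx); rewrite adj_sym. Qed.

Lemma genE x : gen x = gl (x, false).
Proof. by []. Qed.

Lemma glE x b : gl (x, b) = if b then (gen x)^-1 else gen x.
Proof. by case: b; rewrite ?gen_inv. Qed.

Definition rho_gen S x : raag X := if `[< S x >] then gen x else 1.

Lemma rho_gen_commute S (x y : X) : adj x y -> commute (rho_gen S x) (rho_gen S y).
Proof.
rewrite /rho_gen => xy; case: ifP => _; case: ifP => _.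
- exact: gen_commute.
- exact: commute1.
- exact/commute_sym/commute1.
- exact: commute1.
Qed.

(** The retraction onto the subgroup generated by [S] that kills all other generators. *)
Definition rho S : raag X -> raag X := raag_lift (rho_gen S).

Lemma rho_class S w :
  rho S (raag_class w) = raag_class [seq l <- w | `[< S l.1 >]].
Proof.
rewrite /rho (raag_liftE (@rho_gen_commute S)) /word_eval.
elim: w => [|[x b] w IH] /=; first by rewrite big_nil.
rewrite big_cons IH /= /rho_gen; case: (asboolP (S x)) => _; last first.
  by case: b; rewrite ?invg1 mul1g.
by rewrite gl_cons glE.
Qed.

Lemma rhoM S g h : rho S (g * h) = rho S g * rho S h.
Proof. exact: (raag_liftM (@rho_gen_commute S)). Qed.

Lemma rho1 S : rho S 1 = 1.
Proof. by rewrite -raag_class1 rho_class. Qed.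

Lemma rhoV S g : rho S g^-1 = (rho S g)^-1.
Proof. by apply: (mulgI (rho S g)); rewrite -rhoM !mulgV rho1. Qed.

Lemma rhoJ S g h : rho S (g ^ h) = rho S g ^ rho S h.
Proof. by rewrite !conjgE !rhoM rhoV. Qed.

Lemma inA_rho S g : inA S (rho S g).
Proof.
move=> x; rewrite -{1}(nfgK g) rho_class => /leq_trans/(_ (cnt_class_le _ _)).
by rewrite -has_count => /hasP[l]; rewrite mem_filter => /andP[/asboolP Sl _] /eqP <-.
Qed.

Lemma cnt_nfg l g : l \in nfg g -> 0 < cnt l.1 g.
Proof. by move=> lg; rewrite -has_count; apply/hasP; exists l. Qed.

Lemma rho_id S g : inA S g -> rho S g = g.
Proof.
move=> Sg; rewrite -{1}(nfgK g) rho_class -[RHS]nfgK; congr raag_class.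
by apply/all_filterP/allP => l lg; apply/asboolP/Sg/cnt_nfg.
Qed.

Lemma rho_out S g : inA (fun x => ~ S x) g -> rho S g = 1.
Proof.
move=> Sg; rewrite -{1}(nfgK g) rho_class -raag_class1; congr raag_class.
rewrite -(@eq_in_filter _ pred0) ?filter_pred0 // => l lg /=.
by apply/esym/asboolP/Sg/cnt_nfg.
Qed.

Lemma len_rho2 S T g : (forall x, S x -> T x -> False) ->
  len (rho S g) + len (rho T g) <= len g.
Proof.
move=> ST; rewrite -{1 2}(nfgK g) !rho_class.
apply: leq_trans (leq_add (len_class_le _) (len_class_le _)) _.
rewrite /len !size_filter; elim: (nfg g) => //= l w IH.
have : (`[< S l.1 >] + `[< T l.1 >] <= 1)%N.
  by case: asboolP => // Sl; case: asboolP => // Tl; case: (ST _ Sl Tl).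
by lia.
Qed.

Lemma rp_starts l g h : rp g h -> starts l h -> ~~ starts l g^-1.
Proof.
move=> r /startsP[k ? /rp_glE rk]; subst h.
have [/rpV + _] := rpA' rk r.
by rewrite glV => /rp_glE; rewrite linvK.
Qed.

(* [c] is cyclically reduced. *)
Definition cyc c := rp c c.

Lemma cyc_gl l : cyc (gl l).
Proof. by apply/rp_glE; rewrite starts_gl1 eq_sym linv_neq. Qed.

Lemma cyc_pow c n : cyc c ->
  rp c (c ^+ n) /\ forall l, starts l (c ^+ n) -> starts l c.
Proof.
move=> cc; elim: n => [|n [r IH]].
  by split=> [|l]; [exact: rp1 | rewrite expg0 starts1].
have H l : starts l (c ^+ n.+1) -> starts l c.
  rewrite expgS => /(starts_mul _ r)[//|[/IH sl Sl]].
  by have := inA_starts Sl sl; rewrite adj_irr.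
by split=> //; apply: rp_criterion => l /H; exact: rp_starts.
Qed.

Lemma cycV c : cyc c -> cyc c^-1.
Proof. exact: rpV. Qed.

Lemma len_cycX c n : cyc c -> len (c ^+ n) = (n * len c)%N.
Proof.
move=> cc; elim: n => [|n IH]; first by rewrite expg0 len1.
by have [r _] := cyc_pow n cc; rewrite expgS r IH mulSn.
Qed.

Lemma cnt_cycX c n x : cyc c -> cnt x (c ^+ n) = (n * cnt x c)%N.
Proof.
move=> cc; elim: n => [|n IH]; first by rewrite expg0 cnt1.
by have [r _] := cyc_pow n cc; rewrite expgS cnt_rp // IH mulSn.
Qed.

Lemma cycX c n : cyc c -> cyc (c ^+ n).
Proof. by move=> cc; rewrite /cyc /rp -expgnDr !len_cycX // mulnDl. Qed.

Lemma rp_cycX c (m n : nat) : cyc c -> rp (c ^+ m) (c ^+ n).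
Proof. by move=> cc; rewrite /rp -expgnDr !len_cycX // mulnDl. Qed.

(** Powers of [c] grow at the full rate [len c], and conjugation by [z] changes the length of a
    power by at most [2 * len z], independently of the exponent. *)
Lemma cyc_min c z : cyc c -> len c <= len (c ^ z).
Proof.
move=> cc; rewrite leqNgt; apply/negP => lt.
(* With this exponent, a saving of one letter per period exceeds the cost [2 * len z] of conjugating
   back. *)
have := len_conj ((c ^ z) ^+ (2 * len z).+1) z^-1.
rewrite -conjXg conjgK conjXg len_cycX // lenV.
have := lenX (c ^ z) (2 * len z).+1.
set a := len (_ ^+ _); set b := len (c ^ z) in lt *.
move: (len c) (len z) lt => p q lt; nia.
Qed.

Lemma cyc_exists S g : inA S g ->
  exists c h, [/\ cyc c, inA S c, inA S h & g = c ^ h].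
Proof.
have [n] := ubnP (len g); elim: n g => // n IH g ltn Sg.
have [cg|ncg] := pselect (cyc g).
  by exists g, 1; rewrite conjg1; split=> //; exact: inA1.
have [l [sl sVl]] : exists l, starts l g /\ starts l g^-1.
  apply: contrapT => H; apply/ncg/rp_criterion => l sl.
  by apply/negP => sVl; apply: H; exists l.
have Sl := inA_starts Sg sl.
have Sgl : inA S (gl l) by exact/inA_gl.
have [||c [h [cc Sc Sh e]]] := IH (g ^ gl l); last first.
- exists c, (h * (gl l)^-1); split=> //; first by apply: inAM => //; exact: inAV.
  by rewrite conjgM -e conjgK.
- exact: inAJ.
apply: leq_ltn_trans (_ : _ <= (len g).-1) _; last first.
  by have := starts_len sl; lia.
case/startsP: sl => k ? /rp_glE /[dup] rlk /rpV; subst g => rk.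
move: sVl; rewrite invgM => /(starts_mul _ rk)[|[]]; last first.
  by rewrite glV starts_gl1 linv_neq.
move=> sk; rewrite rlk len_gl1 add1n /=.
have -> : (gl l * k) ^ gl l = (gl (linv l) * k^-1)^-1.
  by rewrite conjgE -mulgA mulKg invgM invgK glV linvK.
by rewrite lenV -(lenV k) (starts_len sk).
Qed.

End Cyclic.

(** * Centralisers and pure factors *)

Section Centraliser.
Variable X : graph.
Implicit Types (l m : X * bool) (w : word X) (c g h k p : raag X) (x y z : X).
Implicit Types (S T : X -> Prop).

Lemma commute_conj (G : groupType) (g h k : G) :
  commute g h -> commute (g ^ k) (h ^ k).
Proof. by rewrite /commute -!conjMg => ->. Qed.

Lemma commute_conjE (G : groupType) (g h k : G) :
  commute (g ^ k) (h ^ k) -> commute g h.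
Proof. by move/(commute_conj k^-1); rewrite !conjgK. Qed.

Lemma conj_commute (G : groupType) (g h : G) : commute g h -> g ^ h = g.
Proof. by move=> e; rewrite conjgE e mulKg. Qed.

Lemma commute_fix (G : groupType) (g h : G) : g ^ h = g -> commute g h.
Proof. by move=> e; apply: (mulgI h^-1); rewrite mulKg -conjgE. Qed.

Lemma conj_inA S T g h : (forall x y, S x -> T y -> adj x y) ->
  inA S g -> inA T h -> g ^ h = g.
Proof. by move=> ST Sg Th; apply: conj_commute; exact: commute_inA ST Sg Th. Qed.

Lemma lkF S x : S x -> lk S x -> False.
Proof. by move=> Sx /(_ x Sx); rewrite adj_irr. Qed.

Lemma len_rho_lt S x g : sup g x -> ~ S x -> len (rho S g) < len g.
Proof.
move=> gx Sx; rewrite -{1}(nfgK g) rho_class.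
apply: leq_ltn_trans (len_class_le _) _; rewrite size_filter /len.
rewrite -(count_predC (fun l => `[< S l.1 >])) -addn1 leq_add2l.
apply: leq_trans gx _; apply: sub_count => l /= /eqP ->.
exact/asboolP.
Qed.

(* A conjugate of [c] that misses a letter of [c] would be conjugate to the   *)
(* shorter element obtained from [c] by killing this letter.                  *)
Lemma sup_conj_inA c h x : cyc c -> sup c x -> sup (c ^ h) x.
Proof.
move=> cc cx; rewrite /sup lt0n; apply/eqP => x0.
pose T z := z <> x.
have Tch : inA T (c ^ h) by move=> z zc zx; move: zc; rewrite zx x0.
have e : rho T c = c ^ (h * (rho T h)^-1).
  by rewrite conjgM -(rho_id Tch) rhoJ conjgK.
have := cyc_min (h * (rho T h)^-1) cc; rewrite -e leqNgt.
by rewrite (len_rho_lt cx) // => /(_ erefl).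
Qed.

(** Split off from [k] its part over [sup c] and the link. The remaining [t] starts with no such
    letter, so nothing cancels in [t^-1 * (c ^ h1 * t)], and the length bound forces [t = 1]. *)
Lemma conj_cyc c k : cyc c -> len (c ^ k) <= len c ->
  exists h1 h2, [/\ k = h1 * h2, inA (sup c) h1 & inA (lk (sup c)) h2].
Proof.
move=> cc; have [s [t [-> rst Ss Ht]]] := coset_dec (fun x => sup c x \/ lk (sup c) x) k.
have [h1 [h2 [? S1 S2]]] := inA_split (@lk_adj X (sup c)) Ss; subst s.
have Sc1 : inA (sup c) (c ^ h1) by exact: inAJ.
have e : c ^ (h1 * h2 * t) = t^-1 * (c ^ h1 * t).
  by rewrite !conjgM (conj_inA (@lk_adj X (sup c)) Sc1 S2) conjgE.
have r1 : rp (c ^ h1) t.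
  apply: rp_criterion => l sl; apply/negP => sV.
  by apply: (Ht l sl); left; exact: inA_starts (inAV Sc1) sV.
have r2 : rp t^-1 (c ^ h1 * t).
  apply: rp_criterion => l sl; apply/negP; rewrite invgK => st.
  case/(starts_mul _ r1): sl => [s1|[_ Sl]].
    by apply: (Ht l st); left; exact: inA_starts Sc1 s1.
  by apply: (Ht l st); right=> x /(sup_conj_inA h1 cc)/Sl.
rewrite e r2 r1 lenV => le.
have lt := cyc_min h1 cc.
have /len_eq0 t1 : len t = 0 by lia.
by exists h1, h2; rewrite t1 mulg1.
Qed.

Lemma commute_cyc c k : cyc c -> commute k c ->
  exists h1 h2, [/\ k = h1 * h2, inA (sup c) h1, inA (lk (sup c)) h2 & commute h1 c].
Proof.
move=> cc kc; have e : c ^ k = c by apply: conj_commute; exact: commute_sym.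
have [|h1 [h2 [ek S1 S2]]] := conj_cyc (k := k) cc; first by rewrite e.
exists h1, h2; split=> //; apply: commute_sym; apply: commute_fix.
have Sc1 : inA (sup c) (c ^ h1) by exact: inAJ.
by rewrite -[RHS]e ek conjgM (conj_inA (@lk_adj X (sup c)) Sc1 S2).
Qed.

Lemma sup_conj_cyc c k : cyc c -> cyc (c ^ k) -> sup (c ^ k) = sup c.
Proof.
move=> cc ck; apply/funext => x; apply/propext; split; last exact: sup_conj_inA.
by move/(sup_conj_inA k^-1 ck); rewrite conjgK.
Qed.

(* [irr S] says that the complement graph is connected on [S], i.e. that the  *)
(* subgraph induced on [S] is not a join.                                     *)
Definition irr S := forall T, (exists x, S x /\ T x) -> (exists x, S x /\ ~ T x) ->
  exists x y, [/\ S x, T x, S y, ~ T y & ~~ adj x y].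

Definition pure_at p c h := [/\ cyc c, c <> 1, irr (sup c) & p = c ^ h].
Definition pure p := exists c h, pure_at p c h.

(** The retractions onto the two sides of the join recover [c1] and [c2] from [c]. Applied to
    [c ^ h1 = c], they show that whatever commutes with [c] commutes with each factor. *)
Lemma cyc_split c T : cyc c ->
  (forall x y, sup c x -> T x -> sup c y -> ~ T y -> adj x y) ->
  exists c1 c2, [/\ c = c1 * c2, cyc c1, cyc c2,
    inA (fun x => sup c x /\ T x) c1 /\ inA (fun x => sup c x /\ ~ T x) c2 &
    forall k, commute k c -> commute k c1 /\ commute k c2].
Proof.
move=> cc HT.
pose S1 x := sup c x /\ T x; pose S2 x := sup c x /\ ~ T x.
have S12 x y : S1 x -> S2 y -> adj x y by move=> [? ?] [? ?]; exact: HT.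
have S21 x y : S2 x -> S1 y -> adj x y by rewrite adj_sym => *; exact: S12.
have Sdec g : inA (sup c) g -> exists s t, [/\ g = s * t, inA S1 s & inA S2 t].
  move=> Sg; apply: inA_split => // x /Sg cx.
  by have [Tx|Tx] := pselect (T x); [left|right].
have [c1 [c2 [ec Sc1 Sc2]]] := Sdec c (inA_sup (g := c)).
have r12 : rho S1 c2 = 1 by apply: rho_out; apply: inA_sub Sc2 => x [_ Tx] [_].
have r21 : rho S2 c1 = 1 by apply: rho_out; apply: inA_sub Sc1 => x [_ Tx] [_].
have cE1 : rho S1 c = c1 by rewrite ec rhoM r12 rho_id // mulg1.
have cE2 : rho S2 c = c2 by rewrite ec rhoM r21 rho_id // mul1g.
have lc : len c1 + len c2 <= len c.
  by rewrite -{1}cE1 -cE2; apply: len_rho2 => x [_ Tx] [_].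
have c12 : commute c1 c2 by exact: commute_inA S12 Sc1 Sc2.
have e2 : c * c = (c1 * c1) * (c2 * c2).
  by rewrite ec !mulgA -(mulgA c1 c2) -c12 !mulgA.
have := cc; rewrite {1}/cyc /rp e2 => lcc.
have := lenM (c1 * c1) (c2 * c2); have := lenM c1 c1; have := lenM c2 c2.
move=> l1 l2 l3.
exists c1, c2; split=> //; try by rewrite /cyc /rp; rlia.
move=> k kc; have [h1 [h2 [-> S1h S2h h1c]]] := commute_cyc cc kc.
have [s [t [e Ss St]]] := Sdec h1 S1h.
have h2c g : inA (sup c) g -> commute h2 g.
  by move=> Sg; apply: commute_sym; exact: commute_inA (@lk_adj X (sup c)) Sg S2h.
have Sc1' : inA (sup c) c1 by apply: inA_sub Sc1 => x [].
have Sc2' : inA (sup c) c2 by apply: inA_sub Sc2 => x [].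
have e3 : c ^ h1 = c by apply: conj_commute; exact: commute_sym.
have k1 : commute h1 c1.
  apply: commute_sym; apply: commute_fix; rewrite e conjgM.
  rewrite (conj_inA S12 (inAJ Sc1 Ss) St).
  have rs : rho S1 h1 = s.
    by rewrite e rhoM (rho_id Ss) (_ : rho S1 t = 1) ?mulg1 //;
       apply: rho_out; apply: inA_sub St => x [_ Tx] [_].
  by rewrite -{1}cE1 -rs -rhoJ e3.
have k2 : commute h1 c2.
  apply: commute_sym; apply: commute_fix; rewrite e.
  have -> : s * t = t * s by exact: commute_inA S12 Ss St.
  rewrite conjgM (conj_inA S21 (inAJ Sc2 St) Ss).
  have rt : rho S2 h1 = t.
    by rewrite e rhoM (rho_id St) (_ : rho S2 s = 1) ?mul1g //;
       apply: rho_out; apply: inA_sub Ss => x [_ Tx] [_].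
  by rewrite -{1}cE2 -rt -rhoJ e3.
by split; apply: commute_sym; apply: commuteM; apply: commute_sym => //; exact: h2c.
Qed.

Lemma pure_dec g : exists ps : seq (raag X),
  [/\ forall p, p \in ps -> pure p,
      forall p, p \in ps -> forall k, commute k g -> commute k p &
      g = \prod_(p <- ps) p].
Proof.
have [c [h [cc _ _ ->]]] := cyc_exists (S := fun=> True) (g := g) (fun _ _ => I).
have [n] := ubnP (len c); elim: n c h cc => // n IH c h cc ltn.
have [->|c1] := pselect (c = 1); first by exists [::]; rewrite big_nil conj1g.
have [ir|nir] := pselect (irr (sup c)).
  exists [:: c ^ h]; rewrite big_seq1; split=> // p; rewrite inE => /eqP -> //.
  by exists c, h.
have [T [[x1 [cx1 Tx1]] [x2 [cx2 Tx2]] HT]] : exists T,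
  [/\ exists x, sup c x /\ T x, exists x, sup c x /\ ~ T x &
    forall x y, sup c x -> T x -> sup c y -> ~ T y -> adj x y].
  apply: contrapT => H; apply: nir => T T1 T2; apply: contrapT => H2.
  apply: H; exists T; split=> // x y *; apply: contrapT => /negP nxy.
  by apply: H2; exists x, y.
have [d1 [d2 [ec cd1 cd2 [S1 S2] H]]] := cyc_split cc HT.
have lt1 : len d1 < n.
  rewrite -ltnS; apply: leq_trans ltn; rewrite ltnS.
  have r1 : rho T d1 = d1 by apply: rho_id; apply: inA_sub S1 => x [].
  have r2 : rho T d2 = 1 by apply: rho_out; apply: inA_sub S2 => x [].
  by rewrite -r1 -[rho T d1]mulg1 -r2 -rhoM -ec; exact: len_rho_lt cx2 Tx2.
have lt2 : len d2 < n.
  rewrite -ltnS; apply: leq_trans ltn; rewrite ltnS.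
  pose T' x := ~ T x.
  have r2 : rho T' d2 = d2 by apply: rho_id; apply: inA_sub S2 => x [].
  have r1 : rho T' d1 = 1 by apply: rho_out; apply: inA_sub S1 => x [_ Tx] /(_ Tx).
  rewrite -r2 -[rho T' d2]mul1g -r1 -rhoM -ec.
  by apply: (len_rho_lt cx1) => /(_ Tx1).
have [ps1 [P1 C1 e1]] := IH d1 h cd1 lt1.
have [ps2 [P2 C2 e2]] := IH d2 h cd2 lt2.
exists (ps1 ++ ps2); rewrite big_cat /= -e1 -e2 -conjMg -ec; split=> // p.
  by rewrite mem_cat => /orP[/P1|/P2].
rewrite mem_cat => pp k kc.
have [|k1 k2] := H (k ^ h^-1).
  by apply: (commute_conjE (k := h)); rewrite conjgKV.
have {}k1 : commute k (d1 ^ h) by rewrite -(conjgKV h k); exact: commute_conj.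
have {}k2 : commute k (d2 ^ h) by rewrite -(conjgKV h k); exact: commute_conj.
by case/orP: pp => [/C1|/C2]; apply.
Qed.

End Centraliser.

(** * Powers of irreducible elements *)

Section Irreducible.
Variable X : graph.
Implicit Types (l m : X * bool) (w : word X) (c g h k p : raag X) (x y z v : X).
Implicit Types (S T : X -> Prop).

Lemma count_add_le (A : Type) (a b d : pred A) (s : seq A) :
  (forall i, a i + b i <= d i) -> count a s + count b s <= count d s.
Proof. by move=> H; elim: s => //= i s IH; have := H i; lia. Qed.

Lemma cnt_len x g : cnt x g <= len g.
Proof. exact: count_size. Qed.

Lemma supV c : sup c^-1 = sup c.
Proof. by apply/funext => x; rewrite /sup cntV. Qed.

Lemma sup_cycX c n : cyc c -> 0 < n -> sup (c ^+ n) = sup c.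
Proof.
by move=> cc n0; apply/funext => x; rewrite /sup cnt_cycX // muln_gt0 n0.
Qed.

(* A prefix of a power of [c] that misses a letter of the first copy of [c]   *)
(* misses, from the second copy on, a letter that does not commute with it,   *)
(* and so on: since [c] is irreducible, the prefix only reaches the first     *)
(* [len c] copies.                                                            *)
Lemma prefix_missing c M s r T n : cyc c -> irr (sup c) ->
  c ^+ M = s * r -> rp s r ->
  (exists x, sup c x /\ T x) -> (forall x, T x -> cnt x s = 0) ->
  count (fun l => `[< ~ T l.1 >]) (nfg c) <= n ->
  (forall x, cnt x s <= (n * cnt x c)%N) /\ len s <= (n * len c)%N.
Proof.
move=> cc ic.
have base M' s' r' T' : c ^+ M' = s' * r' -> rp s' r' ->
    (forall x, sup c x -> T' x) -> (forall x, T' x -> cnt x s' = 0) -> s' = 1.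
  move=> e rsr allT Ts; apply: cnt_eq0 => x.
  have [x0|/allT/Ts //] := posnP (cnt x c).
  by have := cnt_rp x rsr; rewrite -e cnt_cycX // x0 muln0; lia.
elim: n M s r T => [|n IH] M s r T e rsr [x1 [cx1 Tx1]] Ts le;
  have [allT|nall] := pselect (forall x, sup c x -> T x);
  try (by split=> [x|]; rewrite (base _ _ _ _ e rsr allT Ts) ?cnt1 ?len1);
  have {nall}[x2 [cx2 Tx2]] : exists x, sup c x /\ ~ T x by
    (apply: contrapT => H; apply: nall => x cx; apply: contrapT => Tx;
    apply: H; exists x).
  suff : 0 < count (fun l => `[< ~ T l.1 >]) (nfg c) by lia.
  by apply: leq_trans cx2 _; apply: sub_count => l /= /eqP ->; exact/asboolP.
case: M e => [|M] e.
  have /len_eq0 s1 : len s = 0 by move: rsr; rewrite /rp -e expg0 len1; lia.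
  by split=> [x|]; rewrite s1 ?cnt1 ?len1.
have [rc _] := cyc_pow M cc; rewrite expgS in e.
have [s1 [s2 [g1 [h1 [es ec eM [r1 r2 r3 H]]]]]] := prefix_mul rc e rsr.
have [||x [y [cx Tx cy Ty nxy]]] := ic T; [by exists x1|by exists x2|].
pose T' z := T z \/ z = y.
have Ts0 z : T z -> cnt z s1 = 0 /\ cnt z s2 = 0.
  by move=> /Ts; rewrite es cnt_rp //; lia.
have [|||c2 l2] := IH M s2 h1 T' eM r3.
- by exists x1; split=> //; left.
- move=> z [/Ts0[] //|->]; case: (posnP (cnt y s2)) => // ys2.
  have xg : 0 < cnt x g1.
    by move: cx; rewrite /sup ec cnt_rp // (Ts0 x Tx).1.
  by move: nxy; rewrite adj_sym (H _ _ ys2 xg).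
- rewrite -ltnS; apply: leq_trans le; rewrite -addn1.
  apply: leq_trans (leq_add (leqnn _) cy) _; apply: count_add_le => l.
  case: asboolP => [nT'|_] /=; last first.
    by case: eqVneq => // -> /=; case: asboolP.
  case: eqVneq => [ly|_]; first by case: nT'; right.
  by case: asboolP => // nT; case: nT => Tl; apply: nT'; left.
split=> [x'|].
  rewrite es cnt_rp // mulSn leq_add ?c2 //.
  by rewrite [in X in _ <= X]ec cnt_rp // leq_addr.
by rewrite es r1 mulSn leq_add // [in X in _ <= X]ec r2 leq_addr.
Qed.

Lemma prefix_missing1 c M s r x0 : cyc c -> irr (sup c) ->
  c ^+ M = s * r -> rp s r -> sup c x0 -> cnt x0 s = 0 ->
  (forall x, cnt x s <= (len c * cnt x c)%N) /\ len s <= (len c * len c)%N.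
Proof.
move=> cc ic e rsr cx0 sx0.
apply: (prefix_missing (T := fun x => x = x0) cc ic e rsr).
- by exists x0.
- by move=> x ->.
- exact: count_size.
Qed.

Lemma gen_cyc v : cyc (gen v).
Proof. exact: cyc_gl. Qed.

Lemma sup_gen v : sup (gen v) = (fun x => x = v).
Proof.
apply/funext => x; apply/propext; rewrite /sup genE cnt_gl1 /=.
by rewrite lt0b; split=> [/eqP|->].
Qed.

Lemma commute_gen k v : commute k (gen v) -> inA (fun x => x = v \/ adj x v) k.
Proof.
case/(commute_cyc (gen_cyc v)) => h1 [h2 [-> S1 S2 _]].
apply: inAM; [apply: inA_sub S1|apply: inA_sub S2] => x; rewrite sup_gen; first by left.
by move=> H; right; exact: H.
Qed.

(* The conditions on first letters say that [t] is the shortest element of its *)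
(* double coset.                                                              *)
Lemma double_coset S t k k2 : inA S k -> inA S k2 ->
  (forall l, starts l t -> ~ S l.1) -> (forall l, starts l t^-1 -> ~ S l.1) ->
  k * t = t * k2 -> inA (lk (sup t)) k /\ k = k2.
Proof.
move=> + + Ht HtV; elim/raag_ind: k k2 => [|l k nk IH] k2.
  move=> _ _; rewrite mul1g => e; split; first exact: inA1.
  by apply: (mulgI t); rewrite -e mulg1.
case/inA_glM => // Sl Sk Sk2 e.
have r2 : rp t k2.
  apply: rp_criterion => m sm; apply/negP => /HtV; apply.
  exact: inA_starts Sk2 sm.
have r1 : rp (gl l * k) t.
  apply: rp_criterion => m sm; apply/negP => sV; apply: (Ht m sm).
  by apply: inA_starts sV; apply: inAV; apply/inA_glM.
have : starts l (t * k2) by rewrite -e; apply: starts_rp => //; rewrite starts_gl.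
case/(starts_mul _ r2) => [/Ht //|[/startsP[k3 ? nk3] St]]; subst k2.
have [_ Sk3] := (inA_glM S nk3).1 Sk2.
have clt : commute (gl l) t.
  by apply: (commute_inA (S := fun x => x = l.1) (T := adj l.1)) => //;
     [move=> x y -> | exact/inA_gl].
have [|Sk' ek] := IH k3 Sk Sk3.
  by apply: (mulgI (gl l)); rewrite !mulgA e clt mulgA.
by rewrite -ek; split=> //; apply/inA_glM.
Qed.

Lemma inA_pow v g : inA (fun x => x = v) g -> exists b n, g = gl (v, b) ^+ n.
Proof.
elim/raag_ind: g => [_|[x b] g ng IH /inA_glM[//|/= ? /IH{IH}[b' [n e]]]]; subst.
  by exists false, 0.
case: n ng => [|n] ng; first by exists b, 1%N; rewrite mulg1.
exists b', n.+2; rewrite [RHS]expgS; congr (gl (_, _) * _).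
apply/eqP; apply: contraNT ng => nb; rewrite expgS.
have [r _] := cyc_pow n (cyc_gl (v, b')).
by apply: (starts_rp r); rewrite starts_gl1 /linv /= {r}; case: b b' nb => [] [].
Qed.

(** Write [c ^+ M = s * t * s'] with [s], [s'] over the star of [v] and [t] shortest in its double
    coset. Both [k] and its conjugate by the inverse of [c ^+ M] lie over this star, so
    [double_coset] puts a conjugate of [k] over the link of [sup t]. As [t] still contains every
    letter of [c], this is inside the link of [sup c]. *)
Lemma fill c v M k : cyc c -> irr (sup c) -> sup c v -> (2 * len c < M)%N ->
  commute k (gen v) -> commute k (gen v ^ (c ^+ M)) -> commute k c.
Proof.
move=> cc ic cv ltM kv kvM; pose S x := x = v \/ adj x v.
have [[x0 [cx0 Sx0]]|cS] := pselect (exists x, sup c x /\ ~ S x); last first.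
  (* If all of [sup c] lies in the star of [v], irreducibility leaves only the letter [v] itself. *)
  have [b [n ->]] : exists b n, c = gl (v, b) ^+ n.
    apply: inA_pow => x cx; apply: contrapT => xv.
    have [||y [z [cy yv cz zv]]] := ic (fun x => x = v); [by exists v|by exists x|].
    rewrite yv adj_sym => /negP; apply; apply: contrapT => nvz.
    by apply: cS; exists z; split=> // -[/zv|/nvz].
  by apply: commuteX; rewrite glE; case: b => //; exact: commuteV.
have Sk : inA S k by exact: commute_gen.
pose g := c ^+ M; pose k' := k ^ g^-1.
have Sk' : inA S k'.
  by apply: commute_gen; rewrite -(conjgK g (gen v)); exact: commute_conj.
have [s [t0 [eg rst0 Ss Ht0]]] := coset_dec S g.
have [a [b [et0 rab Sa Hb]]] := coset_dec S t0^-1.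
pose t := b^-1; pose s' := a^-1.
have e0 : t0 = t * s' by rewrite -[LHS]invgK et0 invgM.
have rts : rp t s' by exact: rpV.
have Ht l : starts l t -> ~ S l.1 by move=> st; apply: Ht0; rewrite e0; exact: starts_rp.
have HtV l : starts l t^-1 -> ~ S l.1 by rewrite invgK; exact: Hb.
have rst : rp s (t * s') by rewrite -e0.
have eg' : g = s * t * s' by rewrite eg e0 mulgA.
have [rst1 rsts] := rpA' rts rst.
have egM : c ^+ M = s * (t * s') by rewrite -/g eg' mulgA.
have Sx s1 : inA S s1 -> cnt x0 s1 = 0.
  by move=> Ss1; have [//|/Ss1/Sx0] := posnP (cnt x0 s1).
have [ls _] := prefix_missing1 cc ic egM rst cx0 (Sx _ Ss).
have egV : c^-1 ^+ M = a * (s * t)^-1.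
  by rewrite expVgn -/g eg' [LHS]invgM invgK.
have raV : rp a (s * t)^-1 by have := rpV rsts; rewrite invgK.
have cVx0 : sup c^-1 x0 by rewrite supV.
have icV : irr (sup c^-1) by rewrite supV.
have [la _] := prefix_missing1 (cycV cc) icV egV raV cVx0 (Sx _ Sa).
(* Since [s] and [s'] miss [x0], each uses up at most [len c] copies of [c]; more than [2 * len c]
   copies are available. *)
have suptc x : sup c x -> sup t x.
  rewrite /sup => cx; have := cnt_cycX M x cc; rewrite egM !cnt_rp //.
  have la' : cnt x s' <= (len c * cnt x c)%N.
    by rewrite cntV; have := la x; rewrite lenV cntV.
  have : (2 * len c * cnt x c < M * cnt x c)%N by rewrite ltn_pmul2r.
  by have := ls x; lia.
pose k1 := k' ^ s; pose k2 := k ^ a.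
have e12 : k1 * t = t * k2.
  have -> : k1 = k2 ^ t^-1.
    rewrite /k1 /k2 /k' -!conjgM; congr (_ ^ _).
    by rewrite eg' /s' !invgM !invgK !mulgA mulgVK.
  by rewrite conjgE invgK !mulgA mulgVK.
have [Sk1 ek] := double_coset (inAJ Sk' Ss) (inAJ Sk Sa) Ht HtV e12.
have Uk2 : inA (lk (sup c)) k2.
  by rewrite /k2 -ek; apply: inA_sub Sk1 => x Hx y /suptc; exact: Hx.
have Ua : inA (sup c) s'.
  move=> x; rewrite /sup => xs; have := cnt_cycX M x cc; rewrite egM !cnt_rp //.
  by case: (posnP (cnt x c)) => // ->; rewrite muln0; lia.
have kk2 : k = k2.
  rewrite -[LHS](conjgK a k) -/k2 -/s'; apply: conj_inA Uk2 Ua => x y Hx Hy.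
  by rewrite adj_sym; exact: lk_adj Hy Hx.
rewrite kk2; apply: commute_sym.
exact: commute_inA (@lk_adj X (sup c)) (inA_sup (g := c)) Uk2.
Qed.

(** Here [q] is a maximal common prefix: once no first letter is shared, [r^-1 * z] is reduced. *)
Lemma meet g h : exists q r z : raag X,
  [/\ g = q * r, h = q * z & [/\ rp q r, rp q z & rp r^-1 z]].
Proof.
have [n] := ubnP (len g); elim: n g h => // n IH g h ltn.
have [[l [sg sh]]|H] := pselect (exists l, starts l g /\ starts l h); last first.
  exists 1, g, h; rewrite !mul1g; split=> //; split; try exact: rp1g.
  by apply: rp_criterion => l sl; apply/negP; rewrite invgK => sg; apply: H; exists l.
case/startsP: sg => g' ? ng; case/startsP: sh => h' ? nh; subst.
move: ltn; rewrite len_gl // ltnS => ltn.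
have [q [r [z [? ? [r1 r2 r3]]]]] := IH g' h' ltn; subst.
exists (gl l * q), r, z; rewrite !mulgA; split=> //.
by split=> //; [have [] := rpA' r1 ((rp_glE _ _).2 ng)|have [] := rpA' r2 ((rp_glE _ _).2 nh)].
Qed.

(** Peel off the copies of [c] that [s] uses completely. At the first incomplete copy some letter is
    left behind, the rest of the prefix has to avoid it, and [prefix_missing1] bounds that rest. *)
Lemma prefix_reduce c s r n : cyc c -> irr (sup c) -> c ^+ n = s * r -> rp s r ->
  exists i f, s = c ^+ i * f /\ len f <= (len c + len c * len c)%N.
Proof.
move=> cc ic; elim: n s r => [|n IH] s r e rsr.
  have /len_eq0 -> : len s = 0 by move: rsr; rewrite /rp -e expg0 len1; lia.
  by exists 0, 1; rewrite mulg1 len1.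
have [rc _] := cyc_pow n cc; rewrite expgS in e.
have [s1 [s2 [g1 [h1 [es ec en [r1 r2 r3 H]]]]]] := prefix_mul rc e rsr.
have [g11|g11] := pselect (g1 = 1).
  have [i [f [ef lf]]] := IH _ _ en r3.
  exists i.+1, f; split=> //; rewrite es ef expgS -!mulgA.
  by congr (_ * _); rewrite [RHS]ec g11 mulg1.
have [x gx] : exists x, 0 < cnt x g1.
  apply: contrapT => H0; apply/g11/cnt_eq0 => x.
  by have [//|gx] := posnP (cnt x g1); case: H0; exists x.
have s2x : cnt x s2 = 0.
  by have [//|sx] := posnP (cnt x s2); have := H _ _ sx gx; rewrite adj_irr.
have cx : sup c x by rewrite /sup ec cnt_rp // ltn_addl.
have [_ l2] := prefix_missing1 cc ic en r3 cx s2x.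
exists 0, s; split; first by rewrite mul1g.
by rewrite es r1 leq_add // [in X in _ <= X]ec r2 leq_addr.
Qed.

(* An element [k] that commutes with [c] keeps every long power of [c] at     *)
(* bounded distance, hence is a quotient of two prefixes of a power of [c].   *)
Lemma commute_bounded c k : cyc c -> c <> 1 -> irr (sup c) -> inA (sup c) k ->
  commute k c -> exists i j,
    len ((c ^+ i)^-1 * (k * c ^+ j)) <= (2 * (len c + len c * len c))%N.
Proof.
(* The power exceeds twice the length of [k], so every letter of [c] survives in [g1] after up to
   [len k] occurrences are lost at each end. *)
move=> cc c1 ic Sk kc; pose n := (2 * len k).+1.
have [q [r [z [ek en [r1 r2 r3]]]]] := meet k (c ^+ n).
have [a [b [z' [ek' en' [r1' r2' r3']]]]] := meet k^-1 (c ^+ n)^-1.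
pose q2 := a^-1; pose z2 := z'^-1.
have ek2 : k = b^-1 * q2 by rewrite -[LHS]invgK ek' invgM.
have en2 : c ^+ n = z2 * q2 by rewrite -[LHS]invgK en' invgM.
have rz2 : rp z2 q2 by exact: rpV.
have rz2b : rp z2 b by have := rpV r3'; rewrite invgK.
have e : z2 * b = r^-1 * z.
  have -> : r^-1 * z = k^-1 * c ^+ n by rewrite ek en invgM -mulgA mulKg.
  have -> : z2 * b = c ^+ n * k^-1 by rewrite ek2 en2 invgM mulgA mulgK invgK.
  exact: (commuteV (commute_sym (commuteX n kc))).
have [s1 [s2 [g1 [h1 [er ez eb [t1 t2 t3 H]]]]]] := prefix_mul rz2b e r3.
have Sr : inA (sup c) r by move: Sk; rewrite ek => /(inA_rp r1)[].
have g1c x : sup c x -> 0 < cnt x g1.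
  rewrite /sup => cx; have := cnt_cycX n x cc; rewrite en2 cnt_rp // ez cnt_rp //.
  have : cnt x q2 <= len k.
    by rewrite -lenV ek' r1' cntV; apply: leq_trans (leq_addr _ _); exact: cnt_len.
  have : cnt x s1 <= len k.
    rewrite ek r1; apply: leq_trans (_ : len r <= _); last exact: leq_addl.
    by rewrite -lenV er t1; apply: leq_trans (leq_addr _ _); exact: cnt_len.
  by rewrite /n; nia.
have s21 : s2 = 1.
  apply: cnt_eq0 => x; have [//|sx] := posnP (cnt x s2).
  have cx : sup c x by apply: Sr; rewrite -cntV er cnt_rp // ltn_addl.
  by have := H _ _ sx (g1c _ cx); rewrite adj_irr.
have en3 : c ^+ n = s1 * (g1 * q2) by rewrite en2 ez mulgA.
have rs1 : rp s1 (g1 * q2) by move: rz2; rewrite ez => /(rpA t2)[].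
have [i [f [ef lf]]] := prefix_reduce cc ic en r2.
have [j [f' [ef' lf']]] := prefix_reduce cc ic en3 rs1.
exists i, j.
have -> : (c ^+ i)^-1 * (k * c ^+ j) = f * f'^-1.
  rewrite ek -[r]invgK er s21 mulg1 ef' ef invgM.
  by rewrite -!mulgA mulKg mulVg mulg1.
apply: leq_trans (lenM _ _) _; rewrite lenV mul2n -addnn; exact: leq_add.
Qed.

End Irreducible.

(** * Commensurability of pure elements *)

Definition spow (G : groupType) (g : G) (b : bool) n : G :=
  (if b then g^-1 else g) ^+ n.

Section Spow.
Variable G : groupType.
Implicit Types (g h k : G) (b : bool) (m n : nat).

Lemma spowE g b n : spow g b n = if b then (g ^+ n)^-1 else g ^+ n.
Proof. by case: b; rewrite /spow ?expVgn. Qed.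

Lemma spow_exp g b n m : spow g b n ^+ m = spow g b (n * m).
Proof. by rewrite /spow expgnA. Qed.

Lemma exp_spow g m b n : spow (g ^+ m) b n = spow g b (m * n).
Proof. by case: b; rewrite /spow ?expgnA ?expVgn. Qed.

Lemma spow_spow g b n b' n' : spow (spow g b n) b' n' = spow g (b (+) b') (n * n').
Proof. by case: b b' => [] []; rewrite /spow /= ?expgnA ?expVgn ?invgK. Qed.

Lemma spow_conj g b n h : spow g b n ^ h = spow (g ^ h) b n.
Proof. by case: b; rewrite /spow conjXg ?conjVg. Qed.

Lemma commute_spow g h b n : commute g h -> commute g (spow h b n).
Proof. by move=> gh; apply: commuteX; case: b => //; exact: commuteV. Qed.

(** Commensurability of the cyclic subgroups generated by [g] and [h]. *)
Definition sim g h := exists m n b, [/\ 0 < m, 0 < n & g ^+ m = spow h b n].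

Lemma sim_refl g : sim g g.
Proof. by exists 1%N, 1%N, false. Qed.

Lemma sim_sym g h : sim g h -> sim h g.
Proof.
move=> [m [n [b [m0 n0 e]]]]; exists n, m, b; split=> //.
by rewrite spowE e spowE; case: (b); rewrite ?invgK.
Qed.

Lemma sim_trans g h k : sim g h -> sim h k -> sim g k.
Proof.
move=> [m [n [b [m0 n0 e]]]] [m' [n' [b' [m0' n0' e']]]].
exists (m * m')%N, (n' * n)%N, (b' (+) b).
rewrite !muln_gt0 m0 m0' n0 n0'; split=> //.
by rewrite expgnA e spow_exp mulnC -exp_spow e' spow_spow.
Qed.

Lemma sim_conj g h k : sim g h -> sim (g ^ k) (h ^ k).
Proof.
move=> [m [n [b [m0 n0 e]]]]; exists m, n, b; split=> //.
by rewrite -conjXg e spow_conj.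
Qed.

End Spow.

Section Commensurable.
Variable X : graph.
Implicit Types (c g h k p : raag X) (x y z v w : X).
Implicit Types (S T : X -> Prop).

Lemma torsion_free g n : 0 < n -> g ^+ n = 1 -> g = 1.
Proof.
have [c [h [cc _ _ ->]]] := cyc_exists (S := fun=> True) (g := g) (fun _ _ => I).
move=> n0; rewrite -conjXg => /eqP; rewrite conjg_eq1 => /eqP/(congr1 (@len X)).
rewrite len_cycX // len1 => /eqP; rewrite muln_eq0 eqn0Ngt n0 => /eqP/len_eq0 ->.
by rewrite conj1g.
Qed.

Lemma finite_ball n : finite_set [set: X] ->
  exists E : seq (raag X), forall g, len g <= n -> g \in E.
Proof.
case/finite_seqP => s es; have sX x : x \in s.
  by have : [set: X]%classic x by []; rewrite es.
elim: n => [|n [E HE]].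
  by exists [:: 1] => g; rewrite leqn0 => /eqP/len_eq0 ->; rewrite inE.
pose L := [seq (x, true) | x <- s] ++ [seq (x, false) | x <- s].
have LX l : l \in L by case: l => x [];
  rewrite mem_cat; apply/orP; [left|right]; apply/mapP; exists x.
exists (1 :: [seq gl l * g | l <- L, g <- E]) => g lg; rewrite inE.
have [//|/eqP/starts_neq1[l]] := eqVneq g 1.
case/startsP => h eg nh; rewrite eg /=.
by apply: allpairs_f (LX l) _; apply: HE; move: lg; rewrite eg len_gl.
Qed.

(** Pigeonhole: by [commute_bounded] each power of [k] becomes an element of one fixed finite ball
    after multiplication by powers of [c]. Two powers of [k] give the same element, which yields a
    relation between powers of [k] and [c]; torsion-freeness makes it non-trivial. *)
Lemma commensurable c k : finite_set [set: X] -> cyc c -> c <> 1 ->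
  irr (sup c) -> inA (sup c) k -> commute k c -> k <> 1 -> sim k c.
Proof.
move=> fX cc c1 ic Sk kc k1.
have [E HE] := finite_ball (2 * (len c + len c * len c)) fX.
have Hij a : exists ij, (c ^+ ij.1)^-1 * (k ^+ a * c ^+ ij.2) \in E.
  have [i [j le]] := commute_bounded cc c1 ic (inAX (n := a) Sk) (commute_sym (commuteX a (commute_sym kc))).
  by exists (i, j); exact: HE.
have [f Hf] := choice Hij.
pose F a := (c ^+ (f a).1)^-1 * (k ^+ a * c ^+ (f a).2).
have nu : ~~ uniq [seq F a | a <- iota 0 (size E).+1].
  apply/negP => u; have := uniq_leq_size u (s2 := E).
  rewrite size_map size_iota ltnn => H; suff: false by [].
  by apply: H => _ /mapP[a _ ->]; exact: Hf.
have [a [b [ab eF]]] : exists a b, a < b /\ F a = F b.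
  apply: contrapT => H; move/negP: nu; apply.
  rewrite map_inj_in_uniq ?iota_uniq // => a b _ _ e.
  by case: (ltngtP a b) => // lt; case: H; [exists a, b|exists b, a].
pose q := ((f b).1 + (f a).2)%N; pose r := ((f a).1 + (f b).2)%N.
have ckX i j : commute (c ^+ i) (k ^+ j) by apply: commuteX2; exact: commute_sym.
have e : c ^+ q = k ^+ (b - a) * c ^+ r.
  apply: (mulgI (k ^+ a)); rewrite mulgA -expgnDr subnKC; last exact: ltnW.
  have ea : k ^+ a * c ^+ (f a).2 = c ^+ (f a).1 * F b.
    by rewrite -eF; exact: (esym (mulVKg _ _)).
  have eb : k ^+ b * c ^+ (f b).2 = c ^+ (f b).1 * F b.
    exact: (esym (mulVKg _ _)).
  have -> : k ^+ a * c ^+ q = c ^+ (f b).1 * (c ^+ (f a).1 * F b).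
    by rewrite -ea /q expgnDr !mulgA ckX.
  have -> : k ^+ b * c ^+ r = c ^+ (f a).1 * (c ^+ (f b).1 * F b).
    by rewrite -eb /r expgnDr !mulgA ckX.
  by rewrite !mulgA -!expgnDr addnC.
have ba : 0 < b - a by rewrite subn_gt0.
case: (ltngtP q r) => lqr.
- exists (b - a)%N, (r - q)%N, true; split=> //; first by rewrite subn_gt0.
  rewrite spowE; apply: (mulIg (c ^+ r)); rewrite -e.
  have -> : c ^+ r = c ^+ (r - q) * c ^+ q by rewrite -expgnDr subnK // ltnW.
  by rewrite mulKg.
- exists (b - a)%N, (q - r)%N, false; split=> //; first by rewrite subn_gt0.
  by rewrite spowE; apply: (mulIg (c ^+ r)); rewrite -e -expgnDr subnK // ltnW.
case: k1; apply: torsion_free ba _; apply: (mulIg (c ^+ r)).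
by rewrite -e lqr mul1g.
Qed.

Lemma cyc_mul S T c g : (forall x y, S x -> T y -> adj x y) ->
  inA S c -> inA T g -> cyc c -> cyc g -> rp c g /\ cyc (c * g).
Proof.
move=> ST Sc Tg cc cg.
have noST l : S l.1 -> T l.1 -> False by move=> Sl /(ST _ _ Sl); rewrite adj_irr.
have r : rp c g.
  apply: rp_criterion => l sl; apply/negP => sV.
  exact: noST (inA_starts (inAV Sc) sV) (inA_starts Tg sl).
split=> //; apply: rp_criterion => l sl; apply/negP.
have cV : commute g^-1 c^-1.
  by apply/commute_sym/(commute_inA ST); exact: inAV.
have rV : rp c^-1 g^-1.
  apply: rp_criterion => m sm; apply/negP; rewrite invgK => sc.
  exact: noST (inA_starts Sc sc) (inA_starts (inAV Tg) sm).
rewrite invgM cV => /(starts_mul _ rV) sV.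
have {}sV : starts l c^-1 \/ starts l g^-1 by case: sV => [|[]]; [left|right].
have {}sl : starts l c \/ starts l g.
  by case/(starts_mul _ r): sl => [|[]]; [left|right].
case: sl sV => sl [] sV.
- by move/negP: (rp_starts cc sl).
- exact: noST (inA_starts Sc sl) (inA_starts (inAV Tg) sV).
- exact: noST (inA_starts (inAV Sc) sV) (inA_starts Tg sl).
- by move/negP: (rp_starts cg sl).
Qed.

Lemma irr_join S T c g : (forall x y, S x -> T y -> adj x y) ->
  inA S c -> inA T g -> irr (sup (c * g)) -> rp c g -> c = 1 \/ g = 1.
Proof.
move=> ST Sc Tg ir r; apply: contrapT => H.
have ex k : k <> 1 -> exists x, sup k x.
  by case/starts_neq1 => l /starts_cnt; exists l.1.
have [x cx] : exists x, sup c x by apply: ex => c1; apply: H; left.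
have [y gy] : exists y, sup g y by apply: ex => g1; apply: H; right.
have suE z : sup (c * g) z <-> sup c z \/ sup g z.
  rewrite /sup cnt_rp // addn_gt0; by split=> /orP.
have dis z : sup c z -> sup g z -> False.
  by move=> /Sc Sz /Tg/(ST _ _ Sz); rewrite adj_irr.
have [||a [b [_ Ta ub Tb nab]]] := ir (sup c).
- by exists x; split=> //; apply/suE; left.
- by exists y; split; [apply/suE; right|move=> /dis; apply].
case/suE: ub => [/Tb//|gb]; move/negP: nab; apply.
by apply: ST; [exact: Sc|exact: Tg].
Qed.

(** * Commuting pure elements that are not commensurable *)

Section PureCommute.
Hypothesis finX : finite_set [set: X].
Variables (p q c e h k : raag X).
Hypotheses (pp : pure_at p c h) (pq : pure_at q e k).
Hypotheses (pqC : commute p q) (npq : ~ sim p q).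

(* Up to conjugacy, [q] is a product of an element with support in [sup c]    *)
(* and one with support in the link of [sup c]; only one of them is           *)
(* non-trivial since [q] is pure, and the first one would be commensurable    *)
(* with [p].                                                                  *)
Lemma pure_commute_lk : inA (lk (sup c)) (q ^ h^-1) /\
  forall w, sup e w -> inA (lk (sup c)) ((gen w ^ k) ^ h^-1).
Proof.
have [cc c1 ic ep] := pp; have [ce e1 ie eq] := pq.
pose r := q ^ h^-1; have erk : r = e ^ (k * h^-1) by rewrite conjgM -eq.
have rc : commute r c.
  by apply: (commute_conjE (k := h)); rewrite conjgKV -ep; exact: commute_sym.
have r1 : r <> 1.
  by rewrite erk => /eqP; rewrite conjg_eq1 => /eqP.
have [y1 [y2 [er S1 S2 y1c]]] := commute_cyc cc rc.
have ST := @lk_adj X (sup c).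
have [e1' [z1 [ce1 Se1 Sz1 ey1]]] := cyc_exists S1.
have [e2 [z2 [ce2 Se2 Sz2 ey2]]] := cyc_exists S2.
have [r12 c12] := cyc_mul ST Se1 Se2 ce1 ce2.
have TS x y : lk (sup c) x -> sup c y -> adj x y.
  by move=> Hx Hy; rewrite adj_sym; exact: lk_adj Hy Hx.
have er' : r = (e1' * e2) ^ (z1 * z2).
  rewrite er ey1 ey2 conjMg !conjgM (conj_inA ST (inAJ Se1 Sz1) Sz2).
  by rewrite (conj_inA TS Se2 Sz1).
pose t := k * h^-1 * (z1 * z2)^-1.
have ee : e1' * e2 = e ^ t by rewrite conjgM -erk er' conjgK.
have supee : sup (e1' * e2) = sup e by rewrite ee; apply: sup_conj_cyc => //; rewrite -ee.
have [e11|e21] : e1' = 1 \/ e2 = 1.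
- by apply: irr_join ST Se1 Se2 _ r12; rewrite supee.
- have ry2 : r = y2 by rewrite er ey1 e11 conj1g mul1g.
  split=> [|w ew]; first by rewrite -/r ry2.
  have et : e2 = e ^ (k * h^-1 * z2^-1).
    by rewrite conjgM -erk ry2 ey2 conjgK.
  have [|h1 [h2 [eh Sh1 Sh2]]] := conj_cyc (c := e) (k := k * h^-1 * z2^-1) ce.
    rewrite -et -(mul1g e2) -e11 ee; have := @cyc_min X (e ^ t) t^-1.
    by rewrite conjgK -ee; apply.
  have supe x : sup e x -> lk (sup c) x.
    by rewrite -supee e11 mul1g; exact: Se2.
  have -> : (gen w ^ k) ^ h^-1 = (gen w ^ h1) ^ z2.
    have -> : (gen w ^ k) ^ h^-1 = (gen w ^ (k * h^-1 * z2^-1)) ^ z2.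
      by rewrite -!conjgM mulgVK.
    rewrite eh conjgM; congr (_ ^ _).
    apply: (conj_inA (@lk_adj X (sup e))) Sh2.
    by apply: inAJ => //; exact/inA_gl.
  apply: inAJ => //; apply: inAJ; first exact/inA_gl/supe.
  exact: inA_sub Sh1.
have ry1 : r = y1 by rewrite er ey2 e21 conj1g mulg1.
case: npq; apply: sim_sym; rewrite ep -(conjgKV h q) -/r; apply: sim_conj.
by apply: commensurable => //; rewrite ry1.
Qed.

Lemma pure_commute_vertices v w : sup c v -> sup e w ->
  [/\ commute q (gen v ^ h), commute (gen v ^ h) (gen w ^ k) & gen v ^ h <> gen w ^ k].
Proof.
move=> cv ew; have [Sq /(_ w ew) Sw] := pure_commute_lk.
have ST := @lk_adj X (sup c).
have Sv : inA (sup c) (gen v) by exact/inA_gl.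
split.
- rewrite -(conjgKV h q); apply/commute_conj/commute_sym.
  exact: commute_inA ST Sv Sq.
- rewrite -(conjgKV h (gen w ^ k)); apply/commute_conj.
  exact: commute_inA ST Sv Sw.
move=> e0; move: Sw; rewrite -e0 conjgK => /inA_gl /=.
exact: lkF.
Qed.

(** Up to conjugacy, [r] commutes with a power of [c], so it has a part over [sup c] and a part over
    the link. A power of the link part lies over both sets, so this part is torsion and vanishes;
    and [q] lives over the link. *)
Lemma pure_commute_sim r : sim r p -> commute r q.
Proof.
move=> [m [n [b [m0 n0]]]]; have [cc c1 ic ep] := pp.
have [Sq _] := pure_commute_lk; have ST := @lk_adj X (sup c).
pose C := spow c b n => er.
have eC : (r ^ h^-1) ^+ m = C.
  by rewrite -conjXg er ep -spow_conj conjgK.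
have cC : cyc C by apply: cycX; case: b {C er eC} => //; exact: cycV.
have sC : sup C = sup c.
  by rewrite sup_cycX //; case: (b); rewrite ?supV //; exact: cycV.
have rC : commute (r ^ h^-1) C by rewrite -eC; exact/commuteX/commute_refl.
have [a1 [a2 [ea S1 S2 a1C]]] := commute_cyc cC rC; rewrite sC in S1 S2.
have a21 : a2 = 1.
  apply: torsion_free m0 _; apply: cnt_eq0 => x.
  have a12 : commute a1 a2 by exact: commute_inA ST S1 S2.
  have e2 : a2 ^+ m = (a1 ^+ m)^-1 * C.
    by rewrite -eC ea (expgMn _ a12) mulKg.
  have [//|x2] := posnP (cnt x (a2 ^+ m)).
  case: (@lkF X (sup c) x); last exact: inAX S2 _ x2.
  have : inA (sup c) (a2 ^+ m); last exact.
  rewrite e2; apply: inAM; first by apply: inAV; exact: inAX.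
  by move=> y; rewrite -sC.
rewrite -(conjgKV h r) -(conjgKV h q); apply: commute_conj.
by apply: commute_inA ST _ Sq; rewrite ea a21 mulg1.
Qed.

End PureCommute.

(* Two distinct such conjugates of [v] fill the support of [p], so that an    *)
(* element commuting with both commutes with [p].                             *)
Lemma pure_vertex_avoid p c h v g : pure_at p c h -> sup c v -> ~ commute g p ->
  exists n, forall i, n < i -> ~ commute g ((gen v ^ h) ^ (p ^+ i)).
Proof.
move=> [cc c1 ic ep] cv ngp.
have [n Hn] : exists n, forall i j, commute g ((gen v ^ h) ^ (p ^+ i)) ->
    n + i < j -> ~ commute g ((gen v ^ h) ^ (p ^+ j)).
  exists (2 * len c)%N => i j gi lij gj; apply: ngp.
  pose g' := g ^ (h * p ^+ i)^-1.
  have e : commute g' c.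
    apply: (@fill X c v (j - i)) => //; first by rewrite ltn_subRL addnC.
    - apply: (commute_conjE (k := h * p ^+ i)).
      by rewrite conjgKV conjgM.
    - apply: (commute_conjE (k := h * p ^+ i)); rewrite conjgKV -conjgM.
      have -> : c ^+ (j - i) * (h * p ^+ i) = h * p ^+ j.
        rewrite mulgA (conjgC _ h) conjXg -ep -mulgA -expgnDr subnK //.
        by apply: ltnW; apply: leq_ltn_trans lij; exact: leq_addl.
      by rewrite conjgM.
  have := commute_conj (h * p ^+ i) e; rewrite conjgKV conjgM -ep.
  by rewrite (conj_commute (commuteX i (commute_refl p))).
have [[i gi]|H] := pselect (exists i, commute g ((gen v ^ h) ^ (p ^+ i))).
  by exists (n + i)%N => j; exact: Hn.
by exists 0 => i _ gi; apply: H; exists i.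
Qed.

End Commensurable.

(** * Ping-pong *)

Section Big.
Variable X : graph.
Implicit Types (l : X * bool) (g h k s t : raag X) (x y z v w : X).

(* [g] starts with an [R]-th power of [v] or of its inverse. *)
Definition big v R g := exists b g',
  g = gl (v, b) ^+ R * g' /\ rp (gl (v, b) ^+ R) g'.

Lemma rp_glX l n g : ~~ starts (linv l) g -> rp (gl l ^+ n) g.
Proof.
move=> ng; apply: rp_criterion => m sm; apply: contra ng.
rewrite -expVgn glV => sV.
have := (cyc_pow n (cyc_gl (linv l))).2 _ sV.
by rewrite starts_gl1 => /eqP ->.
Qed.

Lemma rp_glX_starts l n g : rp (gl l ^+ n.+1) g -> ~~ starts (linv l) g.
Proof.
rewrite expgSr => r; apply/rp_glE.
have [r1 _] := cyc_pow n (cyc_gl l).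
suff r2 : rp (gl l ^+ n) (gl l) by have [] := rpA r2 r.
by have := rp_cycX n 1 (cyc_gl l); rewrite expg1.
Qed.

Lemma vpow_dec v g : exists b n g',
  g = gl (v, b) ^+ n * g' /\ forall d, ~~ starts (v, d) g'.
Proof.
have [s [t [-> _ Ss Ht]]] := coset_dec (fun x => x = v) g.
have [b [n ->]] := inA_pow Ss.
by exists b, n, t; split=> // d; apply/negP => /Ht.
Qed.

Lemma big_lk v R h g : inA (adj v) h -> big v R.+1 g -> big v R.+1 (h * g).
Proof.
move=> Sh [b [g' [-> r]]]; exists b, (h * g'); split.
  have c : commute h (gl (v, b) ^+ R.+1).
    apply/commuteX/commute_sym; apply: (commute_inA (S := fun x => x = v)) Sh => //.
      by move=> x y ->.
    exact/inA_gl.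
  by rewrite !mulgA c.
by apply: rp_glX; rewrite starts_inA_adj //; exact: rp_glX_starts r.
Qed.

Lemma glX_mul v b n b' n' : n' <= n ->
  exists m, n - n' <= m /\ gl (v, b) ^+ n * gl (v, b') ^+ n' = gl (v, b) ^+ m.
Proof.
move=> le; have [<-|nb] := eqVneq b b'.
  by exists (n + n')%N; rewrite expgnDr; split=> //; lia.
exists (n - n')%N; split=> //.
have -> : (v, b') = linv (v, b) by rewrite /linv /=; case: b b' nb => [] [].
by rewrite -glV expVgn -expgnFr.
Qed.

(** At most [R] of the [N] new letters can cancel against [g], and at least [R.+1] remain because
    [N] is at least [2 * R + 1]. *)
Lemma big_push v R b N g : 2 * R.+1 <= N.+1 -> ~ big v R.+1 g ->
  big v R.+1 (gl (v, b) ^+ N * g).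
Proof.
move=> leN ng; have [b' [n [g' [eg fg]]]] := vpow_dec v g.
have [leR|ltR] := leqP R.+1 n.
  case: ng; exists b', (gl (v, b') ^+ (n - R.+1) * g'); split.
    by rewrite mulgA -expgnDr subnKC.
  have r := rp_glX (l := (v, b')) n (fg (~~ b')); move: r.
  rewrite -{1}(subnKC leR) expgnDr => r.
  by have [] := rpA (rp_cycX R.+1 (n - R.+1) (cyc_gl (v, b'))) r.
have [|m [lem em]] := @glX_mul v b N b' n; first by lia.
exists b, (gl (v, b) ^+ (m - R.+1) * g'); split.
  by rewrite eg mulgA em mulgA -expgnDr subnKC //; lia.
have := rp_glX (l := (v, b)) m (fg (~~ b)); rewrite -{1}(@subnKC R.+1 m); last by lia.
rewrite expgnDr => r.
by have [] := rpA (rp_cycX R.+1 (m - R.+1) (cyc_gl (v, b))) r.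
Qed.

(** No letter [w] of [g] can move to the front past the letter [x] of [s], so [s] alone provides all
    [R] of them. *)
Lemma big_cnt w R s g x : rp s g -> sup s x -> x <> w -> ~~ adj x w ->
  big w R (s * g) -> R <= cnt w s.
Proof.
move=> r zx xw nxw [b [g' [e r']]].
have cwR y : cnt y (gl (w, b) ^+ R) = (R * (w == y))%N.
  by rewrite cnt_cycX ?cnt_gl1 //; exact: cyc_gl.
have [s1 [s2 [g1 [h1 [es ez _ [t1 t2 _ H]]]]]] := prefix_mul r e r'.
have xg1 : 0 < cnt x g1.
  have := cwR x; rewrite es cnt_rp // (negPf _ : w == x = false); last first.
    by apply/eqP => wx; apply: xw.
  by move: zx; rewrite /sup ez cnt_rp //; lia.
have s21 : cnt w s2 = 0.
  have [//|sw] := posnP (cnt w s2).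
  by move: nxw; rewrite adj_sym (H _ _ sw xg1).
by have := cwR w; rewrite es eqxx cnt_rp // s21 ez cnt_rp //; lia.
Qed.

Lemma nbig_cnt v R h : cnt v h < R -> ~ big v R h.
Proof.
move=> lt [b [g' [e r]]]; move: lt; rewrite e cnt_rp // cnt_cycX ?cnt_gl1 /= ?eqxx.
  by lia.
exact: cyc_gl.
Qed.

Lemma commute_st w t : inA (fun x => x = w \/ adj x w) t -> commute (gen w) t.
Proof.
move=> St.
have [||s [k [-> Ss Sk]]] := inA_split (S := fun x => x = w) (T := adj w) (g := t).
- by move=> x y ->.
- by apply: inA_sub St => x; rewrite adj_sym.
apply: commuteM.
  have [b [n ->]] := inA_pow Ss; apply: commuteX.
  by rewrite glE; case: b; [apply: commuteV|]; exact: commute_refl.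
apply: (commute_inA (S := fun x => x = w)) Sk; first by move=> x y ->.
exact/inA_gl.
Qed.

(** Such an [s] is a power of [v], with exponent [j] up to sign, times an element over the link. It
    supplies at most [j] initial letters [v]; any further ones come from [g]. *)
Lemma big_st v s : inA (fun x => x = v \/ adj x v) s -> exists j, forall R g,
  j < R -> big v R (s * g) -> exists b, starts (v, b) g.
Proof.
move=> Ss.
have [||s0 [k [-> Ss0 Sk]]] := inA_split (S := fun x => x = v) (T := adj v) (g := s).
- by move=> x y ->.
- by apply: inA_sub Ss => x; rewrite adj_sym.
have [b1 [j ->]] := inA_pow Ss0; exists j => R g ltR [b [g' [e r]]].
apply: contrapT => H.
have fg d : ~~ starts (v, d) (k * g).
  by rewrite starts_inA_adj //; apply/negP => sg; apply: H; exists d.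
rewrite -mulgA in e; have rj := rp_glX (l := (v, b1)) j (fg (~~ b1)).
have [p1 [p2 [g1 [h1 [ep eg1 ek [r1 r2 r3 _]]]]]] := prefix_mul rj e r.
have S12 : inA (fun x => x = v) (p1 * p2) by rewrite -ep; apply: inAX; exact/inA_gl.
have [_ S2] := inA_rp r1 S12.
have p21 : p2 = 1.
  apply: contrapT => /starts_neq1[[x d] sl]; have /= xv := inA_starts S2 sl.
  by move/negP: (fg d); rewrite ek; apply; rewrite -xv; exact: starts_rp.
have := len_cycX R (cyc_gl (v, b)); rewrite ep p21 mulg1.
have := len_cycX j (cyc_gl (v, b1)); rewrite eg1 r2 !len_gl1; lia.
Qed.

(* Behrstock's inequality for the projections to the lines through the cosets *)
(* of the powers of two non-commuting vertices of the extension graph.        *)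
Lemma behrstock v h w k : ~ commute (gen v ^ h) (gen w ^ k) ->
  exists R0, forall R g, R0 <= R -> big v R (h * g) -> ~ big w R (k * g).
Proof.
move=> nc; pose S x := x = v \/ adj x v.
have [s [t [eh rst Ss Ht]]] := coset_dec S (h * k^-1).
have [j Hj] := big_st Ss.
have nct : ~ commute (gen v ^ t) (gen w).
  move=> c; apply: nc; apply: (commute_conjE (k := k^-1)).
  rewrite conjgK -conjgM eh conjgM (conj_commute (h := s)) //.
  exact: commute_st.
(* The first bound exceeds what [s] can supply, and the second exceeds the length of
   [t^-1 * gl (v, b)], hence its number of letters [w]. *)
exists (maxn j.+1 (len t).+2) => R g; rewrite geq_max => /andP[ltj ltt] B1 B2.
have [b] : exists b, starts (v, b) (t * (k * g)).
  by apply: (Hj R) => //; rewrite !mulgA -eh mulgVK.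
case/startsP => g' eg /rp_glE rg'.
have r1 : rp t^-1 (gl (v, b)).
  apply: rp_criterion => l; rewrite starts_gl1 => /eqP <-; rewrite invgK.
  by apply/negP => /Ht; apply; left.
have r2 : rp (t^-1 * gl (v, b)) g'.
  have [] // := rpA' rg' (_ : rp t^-1 (gl (v, b) * g')).
  apply: rp_criterion => l sl; apply/negP; rewrite invgK => /Ht; apply.
  case/(starts_mul _ rg'): sl => [|[_ /inA_gl]]; last by right.
  by rewrite starts_gl1 => /eqP <-; left.
have eg' : k * g = t^-1 * gl (v, b) * g' by rewrite -mulgA -eg mulKg.
have [x [zx xw nxw]] : exists x, [/\ sup (t^-1 * gl (v, b)) x, x <> w & ~~ adj x w].
  apply: contrapT => H; apply: nct.
  have /(inA_rp r1)[St /inA_gl Sv] : inA (fun x => x = w \/ adj x w) (t^-1 * gl (v, b)).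
    move=> x zx; apply: contrapT => nx; apply: H; exists x; split=> //.
      by move=> xw; apply: nx; left.
    by apply/negP => xw; apply: nx; right.
  apply/commute_sym/commute_st; apply: inAJ; first exact/inA_gl.
  by rewrite -(invgK t); exact: inAV.
rewrite eg' in B2; have := big_cnt r2 zx xw nxw B2.
have := cnt_len w (t^-1 * gl (v, b)); rewrite r1 lenV len_gl1; lia.
Qed.

(** What commutes with [gen v] is a power of [v] times an element over the link, and retractions
    compute both parts. For [w] other than [v] the power of [v] dies; for [w = v] the link part dies
    and the two conjugates coincide. *)
Lemma conj_vertex_lk v h w k : commute (gen v ^ h) (gen w ^ k) ->
  gen v ^ h <> gen w ^ k -> inA (adj v) ((gen w ^ k) ^ h^-1).
Proof.
move=> c ne; set g := _ ^ h^-1.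
have cg : commute g (gen v).
  by apply: (commute_conjE (k := h)); rewrite conjgKV; exact: commute_sym.
have [||s [t [eg Ss St]]] := inA_split (S := fun x => x = v) (T := adj v) (g := g).
- by move=> x y ->.
- by apply: inA_sub (commute_gen cg) => x; rewrite adj_sym.
have rt : rho (fun x => x = v) t = 1.
  by apply: rho_out; apply: inA_sub St => x vx xv; move: vx; rewrite xv adj_irr.
have rs : rho (fun x => x = v) g = s by rewrite eg rhoM rt mulg1 rho_id.
have egw : g = gen w ^ (k * h^-1) by rewrite conjgM.
have [wv|wv] := pselect (w = v); last first.
  rewrite eg -rs egw rhoJ rho_out ?conj1g ?mul1g //.
  by move=> x; rewrite cnt_gl1 lt0b => /eqP <-.
case: ne; rewrite -[RHS](conjgKV h) -/g; congr (_ ^ _).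
have rs' : rho (fun x => x <> v) g = t.
  rewrite eg rhoM rho_out ?mul1g ?rho_id //.
    by apply: inA_sub St => x vx xv; move: vx; rewrite xv adj_irr.
  by apply: inA_sub Ss => x -> /(_ erefl).
have t1 : t = 1.
  rewrite -rs' egw rhoJ rho_out ?conj1g // wv.
  by move=> x; rewrite cnt_gl1 lt0b /= => /eqP <- /(_ erefl).
rewrite eg t1 mulg1 -rs egw rhoJ wv rho_id; last first.
  by move=> x; rewrite cnt_gl1 lt0b /= => /eqP <-.
apply/esym/conj_commute/commute_st.
by apply: inA_sub (@inA_rho _ _ _) => x; left.
Qed.

End Big.

(** * Elementary facts on group homomorphisms *)

Section Hom.
Variables (G H : groupType) (f : G -> H).
Hypothesis fM : {morph f : x y / x * y}.

Lemma hom1 : f 1 = 1.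
Proof. by apply: (mulgI (f 1)); rewrite -fM !mulg1. Qed.

Lemma homV x : f x^-1 = (f x)^-1.
Proof. by apply: (mulgI (f x)); rewrite -fM !mulgV hom1. Qed.

Lemma homX n x : f (x ^+ n) = f x ^+ n.
Proof. by elim: n => [|n IH]; rewrite ?hom1 // !expgS fM IH. Qed.

Lemma hom_spow x b n : f (spow x b n) = spow (f x) b n.
Proof. by rewrite /spow homX; case: b; rewrite ?homV. Qed.

Lemma hom_prod (I : Type) (r : seq I) (E : I -> G) :
  f (\prod_(i <- r) E i) = \prod_(i <- r) f (E i).
Proof. exact: (big_morph f fM hom1). Qed.

Lemma hom_inj : (forall x, f x = 1 -> x = 1) -> injective f.
Proof.
by move=> fI x y e; apply/divg1_eq/fI; rewrite fM homV e mulgV.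
Qed.

End Hom.

Section PingPong.
Variables (X Y : graph) (v : Y -> X) (h : Y -> raag X) (N : Y -> nat) (R : nat).
Variable theta : raag Y -> raag X.
Hypothesis thetaM : {morph theta : g k / g * k}.
Hypothesis thetaE : forall y, theta (gen y) = (gen (v y) ^ h y) ^+ N y.
Hypothesis leN : forall y, 2 * R.+1 <= (N y).+1.
Hypothesis adjC : forall y z, adj y z ->
  commute (gen (v y) ^ h y) (gen (v z) ^ h z) /\ gen (v y) ^ h y <> gen (v z) ^ h z.
Hypothesis nadj : forall y z g, y <> z -> ~~ adj y z ->
  big (v y) R.+1 (h y * g) -> ~ big (v z) R.+1 (h z * g).
Hypothesis nbig1 : forall y, ~ big (v y) R.+1 (h y).

Lemma theta_gl y b n : theta (gl (y, b) ^+ n) = gl (v y, b) ^+ (N y * n) ^ h y.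
Proof.
rewrite (homX thetaM) conjXg expgnA; congr (_ ^+ _).
rewrite -conjXg !glE; case: b; rewrite ?(homV thetaM) thetaE -?conjXg //.
by rewrite expVgn conjVg.
Qed.

(** Remove the full initial power of [y] and look at a first letter [z] of the rest. If [z] is not
    adjacent to [y], induction and [nadj] show that the rest is not big for [y], and [big_push]
    applies. If it is adjacent, [z] moves to the front of [g], where its image acts over the link of
    [v y] and preserves bigness. *)
Lemma pingpong_big y b g : starts (y, b) g -> big (v y) R.+1 (h y * theta g).
Proof.
have [n] := ubnP (len g); elim: n g y b => // n IH g y b ltn sg.
have [b' [m [g' [eg fg]]]] := vpow_dec y g.
have m0 : 0 < m.
  by case: m eg => // eg; move/negP: (fg b); rewrite -{1}(mul1g g') -(expg0 (gl (y, b'))) -eg.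
have lg : len g = (m + len g')%N.
  have r := rp_glX (l := (y, b')) m (fg (~~ b')); rewrite eg r len_cycX ?len_gl1 ?muln1 //.
  exact: cyc_gl.
have eth : h y * theta g = gl (v y, b') ^+ (N y * m) * (h y * theta g').
  by rewrite eg thetaM theta_gl conjgE !mulgA mulgV mul1g.
have leNm : 2 * R.+1 <= (N y * m).+1.
  by apply: leq_trans (leN y) _; rewrite ltnS leq_pmulr.
have [g'1|/starts_neq1[[z d] sz]] := pselect (g' = 1).
  rewrite eth g'1 (hom1 thetaM) mulg1; apply: big_push => //; exact: nbig1.
have [yz|/eqP yz] := eqVneq z y; first by move: sz; rewrite yz (negPf (fg d)).
have [ayz|nyz] := boolP (adj y z); last first.
  rewrite eth; apply: big_push => //; apply: (nadj _ _ (y := z)) => //.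
    by rewrite adj_sym.
  by apply: IH sz; lia.
case/startsP: sz => g1 eg1 ng1.
pose g2 := gl (y, b') ^+ m * g1.
have eg2 : g = gl (z, d) * g2.
  rewrite eg eg1 /g2 !mulgA; congr (_ * _); apply/esym/commuteX.
  by apply: gl_commute; rewrite /= adj_sym.
have lg1 : len g' = (len g1).+1 by rewrite eg1 len_gl.
have fg1 : ~~ starts (linv (y, b')) g1.
  have := fg (~~ b'); rewrite eg1 starts_adj //.
have sg2 : starts (y, b') g2.
  apply: starts_rp; first exact: rp_glX.
  by case: (m) m0 => // m' _; rewrite expgS starts_rp ?starts_gl1 //;
     have [] := cyc_pow m' (cyc_gl (y, b')).
have lg2 : len g2 < n.
  have := rp_glX m fg1; rewrite /rp -/g2 len_cycX ?len_gl1; last exact: cyc_gl.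
  by rewrite muln1; lia.
have B2 := IH g2 y b' lg2 sg2.
have [c ne] := adjC ayz.
have Sz := conj_vertex_lk c ne.
have -> : h y * theta g = theta (gl (z, d)) ^ (h y)^-1 * (h y * theta g2).
  by rewrite eg2 thetaM conjgE invgK !mulgA mulgVK.
apply: big_lk B2.
rewrite -[gl _]expg1 theta_gl muln1 !conjXg; apply: inAX.
by rewrite glE; case: (d); rewrite ?conjVg //; exact: inAV.
Qed.

Lemma pingpong : injective theta.
Proof.
apply: (hom_inj thetaM) => g tg; apply: contrapT => /starts_neq1[[y b] /pingpong_big].
by rewrite tg mulg1; exact: nbig1.
Qed.

End PingPong.

(** * Vertices of the extension graph for pure elements *)

Section Homs.
Variable X : graph.

Lemma hom_ext (G : groupType) (f g : raag X -> G) :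
  {morph f : x y / x * y} -> {morph g : x y / x * y} ->
  (forall x, f (gen x) = g (gen x)) -> f =1 g.
Proof.
move=> fM gM e; elim/raag_ind => [|[x b] k _ IH]; first by rewrite !hom1.
by rewrite fM gM IH glE; case: b; rewrite ?(homV fM) ?(homV gM) e.
Qed.

Lemma gen_inj : injective (@gen X).
Proof.
move=> x y e; have : cnt x (gen y) = 1%N by rewrite -e cnt_gl1 eqxx.
by rewrite cnt_gl1 /=; case: eqVneq.
Qed.

Lemma gen_neq1 x : gen x <> 1 :> raag X.
Proof. by move/(congr1 (cnt x)); rewrite cnt_gl1 cnt1 /= eqxx. Qed.

Definition pow_map (N : X -> nat) : raag X -> raag X :=
  raag_lift (fun x => gen x ^+ N x).

Lemma pow_map_commute (N : X -> nat) x y : adj x y ->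
  commute (gen x ^+ N x) (gen y ^+ N y).
Proof. by move=> xy; apply/commuteX2/gen_commute. Qed.

Lemma pow_mapM N : {morph pow_map N : g h / g * h}.
Proof. exact: (raag_liftM (@pow_map_commute N)). Qed.

Lemma pow_map_gen N x : pow_map N (gen x) = gen x ^+ N x.
Proof. exact: (raag_lift_gen (@pow_map_commute N)). Qed.

Lemma big_starts v (g : raag X) : big v 1 g -> exists b, starts (v, b) g.
Proof.
case=> b [g' [-> r]]; exists b; apply: starts_rp => //.
by rewrite expg1 starts_gl1.
Qed.

(** Ping-pong with trivial conjugators and [R = 0]: being big just means having the right first
    letter, and [exchange] separates non-adjacent vertices. *)
Lemma pow_map_inj N : (forall x, 0 < N x) -> injective (pow_map N).
Proof.
move=> N0; apply: (@pingpong X X id (fun=> 1) N 0) => //=.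
- exact: pow_mapM.
- by move=> y; rewrite conjg1 pow_map_gen.
- move=> y z yz; rewrite !conjg1; split; first exact: gen_commute.
  by move/gen_inj => e; move: yz; rewrite e adj_irr.
- move=> y z g yz nyz; rewrite mul1g => /big_starts[b sb] /big_starts[d sd].
  have [|/=] := exchange sb sd; first by apply/eqP => -[].
  by rewrite (negPf nyz).
by move=> y; apply: nbig_cnt; rewrite cnt1.
Qed.

End Homs.

Section Choose.
Variables (X : graph) (I : eqType) (P C H : I -> raag X) (V : I -> X).
Hypothesis pureP : forall i, pure_at (P i) (C i) (H i).
Hypothesis supV : forall i, sup (C i) (V i).

Definition pvertex i n := (gen (V i) ^ H i) ^ (P i ^+ n).

Lemma avoid_list i (Z : seq (raag X)) : exists n, forall m, n < m ->
  forall z, z \in Z -> ~ commute z (P i) -> ~ commute z (pvertex i m).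
Proof.
elim: Z => [|z Z [n Hn]]; first by exists 0.
have [c|nc] := pselect (commute z (P i)).
  exists n => m lt z'; rewrite inE => /orP[/eqP -> /(_ c)//|]; exact: Hn.
have [n' Hn'] := pure_vertex_avoid (pureP i) (supV i) nc.
exists (maxn n n') => m; rewrite gtn_max => /andP[lt lt'] z'.
by rewrite inE => /orP[/eqP -> _|zZ]; [exact: Hn'|exact: Hn].
Qed.

(** The list [Z] serves the induction: it collects the vertices already chosen. A new vertex must
    also fail to commute with each later [P j] that does not commute with [P i], since only then can
    the vertex for [j] be made to avoid it. *)
Lemma choose_exponents (s : seq I) (Z : seq (raag X)) : uniq s ->
  exists M : I -> nat,
   (forall i z, i \in s -> z \in Z -> ~ commute z (P i) ->
      ~ commute z (pvertex i (M i))) /\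
   (forall i j, i \in s -> j \in s -> ~ commute (P i) (P j) ->
      ~ commute (pvertex i (M i)) (pvertex j (M j))).
Proof.
elim: s Z => [|i s IH] Z /=; first by exists (fun=> 0).
move=> /andP[nis us]; have [n Hn] := avoid_list i (Z ++ [seq P j | j <- s]).
have {Hn}Hi := Hn n.+1 (ltnSn _).
have [M [H1 H2]] := IH (pvertex i n.+1 :: Z) us.
exists (fun j => if j == i then n.+1 else M j).
have ne j : j \in s -> (j == i) = false.
  by move=> js; apply: contraNF nis => /eqP <-.
have Hij j : j \in s -> ~ commute (P i) (P j) ->
    ~ commute (pvertex i n.+1) (pvertex j (M j)).
  move=> js nc; apply: H1 => //; first by rewrite inE eqxx.
  move=> /commute_sym; apply: Hi; last by move/commute_sym.
  by rewrite mem_cat map_f ?orbT.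
split=> [j z|j k].
  rewrite inE => /orP[/eqP ->|js] zZ nc; rewrite ?eqxx ?ne //.
    by apply: Hi => //; rewrite mem_cat zZ.
  by apply: H1 => //; rewrite inE zZ orbT.
rewrite !inE => /orP[/eqP ->|js] /orP[/eqP ->|ks] nc; rewrite ?eqxx ?ne //.
- by case: nc; exact: commute_refl.
- exact: Hij.
- by move=> /commute_sym; apply: Hij => // /commute_sym.
exact: H2.
Qed.

Lemma pvertexE i n : pvertex i n = gen (V i) ^ (H i * P i ^+ n).
Proof. by rewrite conjgM. Qed.

Lemma pvertex_adj i j m n : finite_set [set: X] -> commute (P i) (P j) ->
  ~ sim (P i) (P j) ->
  commute (pvertex i m) (pvertex j n) /\ pvertex i m <> pvertex j n.
Proof.
move=> finX cij nij.
have [ci cc ne] := pure_commute_vertices finX (pureP i) (pureP j) cij nij (supV i) (supV j).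
have nji : ~ sim (P j) (P i) by move/sim_sym.
have [cj _ _] := pure_commute_vertices finX (pureP j) (pureP i) (commute_sym cij) nji (supV j) (supV i).
(* Each of [P i], [P j] commutes with the base vertex of the other, so both vertices arise from
   their base vertices by the same conjugation. *)
pose t := P i ^+ m * P j ^+ n.
have e1 : pvertex i m = (gen (V i) ^ H i) ^ t.
  rewrite /t conjgM; apply/esym/conj_commute/commute_sym; rewrite /pvertex.
  rewrite -(conj_commute (commuteX2 n m (commute_sym cij))).
  by apply/commute_conj/commute_sym/commuteX/commute_sym.
have e2 : pvertex j n = (gen (V j) ^ H j) ^ t.
  rewrite /t (_ : _ * _ = P j ^+ n * P i ^+ m); last exact: commuteX2.
  rewrite conjgM; apply/esym/conj_commute/commute_sym; rewrite /pvertex.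
  rewrite -(conj_commute (commuteX2 m n cij)).
  by apply/commute_conj/commute_sym/commuteX/commute_sym.
split; first by rewrite e1 e2; exact: commute_conj.
by rewrite e1 e2 => /conjg_inj.
Qed.

End Choose.

Lemma representatives (A : eqType) (R : A -> A -> Prop) (s : seq A) :
  (forall a, R a a) -> (forall a b, R a b -> R b a) -> exists t : seq A,
  [/\ {subset t <= s}, forall a, a \in s -> exists2 b, b \in t & R a b &
      forall a b, a \in t -> b \in t -> a <> b -> ~ R a b].
Proof.
move=> Rr Rs; elim: s => [|a s [t [ts st tt]]]; first by exists [::].
have [[b bt Rab]|H] := pselect (exists2 b, b \in t & R a b).
  exists t; split=> // [c /ts|c]; first by rewrite inE => ->; rewrite orbT.
  by rewrite inE => /orP[/eqP ->|/st //]; exists b.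
exists (a :: t); split=> [c|c|b c].
- by rewrite !inE => /orP[->//|/ts ->]; rewrite orbT.
- rewrite inE => /orP[/eqP ->|/st[b bt Rcb]]; first by exists a; rewrite ?inE ?eqxx.
  by exists b; rewrite ?inE ?bt ?orbT.
rewrite !inE => /orP[/eqP ->|bt] /orP[/eqP ->|ct] // nbc.
- by move=> Rac; apply: H; exists c.
- by move/Rs => Rab; apply: H; exists b.
exact: tt.
Qed.

Section Cliques.
Variable X : graph.
Implicit Types (g h : raag X) (K : X -> Prop).

Lemma supp_sup g : supp g = sup g.
Proof.
rewrite suppE; apply/seteqP; split=> x.
  move=> [w [wg rw [b xw]]]; have := rw (nfg g); rewrite nfgK wg => /(_ erefl) le.
  have nw : nored w.
    apply: nf_size_nored; apply/eqP; rewrite eqn_leq size_nf.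
    by rewrite -len_class wg.
  rewrite /sup -wg (cnt_teq x (nfg_nored nw)) -has_count.
  by apply/hasP; exists (x, b) => //=.
rewrite /sup /cnt -has_count => /hasP[[y b] yw /= /eqP <-].
exists (nfg g); split; [exact: nfgK| |by exists b].
by move=> w'; rewrite nfgK => <-; exact: len_class_le.
Qed.

Lemma commute_clique K g h : clique K -> inA K g -> inA K h -> commute g h.
Proof.
move=> cK; elim/raag_ind: g => [*|l g ng IH /inA_glM].
  exact/commute_sym/commute1.
case=> // Kl Kg Kh; apply/commute_sym/commuteM; last exact/commute_sym/IH.
elim/raag_ind: h Kh {IH} => [*|m h nh IH /inA_glM]; first exact/commute_sym/commute1.
case=> // Km Kh; apply/commute_sym/commuteM; last exact/commute_sym/IH.
have [e|ne] := pselect (l.1 = m.1); last exact/gl_commute/cK.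
case: l m e {ng Kl IH nh Km} => [x b] [y c] /= <-; rewrite !glE.
have r : commute (gen x) (gen x) by exact: commute_refl.
by case: b c => [] []; [apply/commuteV/commute_sym/commuteV|apply/commute_sym/commuteV
  |apply/commuteV|].
Qed.

End Cliques.

Section CommutationGraph.
Variables (G : groupType) (t : seq G).

Definition commutation_adj (i j : seq_sub t) : bool :=
  (i != j) && (val i * val j == val j * val i).

Lemma commutation_adj_sym : symmetric commutation_adj.
Proof. by move=> i j; rewrite /commutation_adj eq_sym [_ * _ == _]eq_sym. Qed.

Lemma commutation_adj_irr : irreflexive commutation_adj.
Proof. by move=> i; rewrite /commutation_adj eqxx. Qed.

Definition commutation_graph : graph :=
  Graph commutation_adj_sym commutation_adj_irr.

Lemma commutation_adjP (i j : commutation_graph) :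
  reflect (i <> j /\ commute (val (i : seq_sub t)) (val (j : seq_sub t))) (adj i j).
Proof.
apply: (iffP andP) => [[/eqP ? /eqP ?]|[/eqP ? /eqP ?]]; by split.
Qed.

End CommutationGraph.

(** * Placing the commutation graph inside the extension graph *)

Section Realisation.
Variables (X : graph) (t : seq (raag X)).
Hypothesis finX : finite_set [set: X].
Hypothesis tpure : forall p, p \in t -> pure p.
Hypothesis tsim : forall p q, p \in t -> q \in t -> p <> q -> ~ sim p q.
Let Y := commutation_graph t.

Lemma realisation : exists (a : Y -> ext_graph X) (N : nat), [/\ 0 < N,
  forall y z, adj y z -> adj (a y) (a z) &
  forall theta : raag Y -> raag X, {morph theta : g h / g * h} ->
    (forall y, theta (gen y) = val (a y : ext_vertex X) ^+ N) -> injective theta].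
Proof.
pose P (y : seq_sub t) := val y.
have exd (y : seq_sub t) : exists d : raag X * raag X * X,
    pure_at (P y) d.1.1 d.1.2 /\ sup d.1.1 d.2.
  have [c [h pc]] := tpure (valP y).
  have [_ c1 _ _] := pc; have [l /starts_cnt sl] := starts_neq1 c1.
  by exists (c, h, l.1).
have [d Hd] := choice exd.
pose C y := (d y).1.1; pose H y := (d y).1.2; pose V y := (d y).2.
have pP y : pure_at (P y) (C y) (H y) by case: (Hd y).
have sV y : sup (C y) (V y) by case: (Hd y).
have [M [_ HM]] := choose_exponents pP sV [::] (enum_uniq {: seq_sub t}).
pose alpha y := pvertex P H V y (M y).
pose h y := H y * P y ^+ M y.
have alphaE y : alpha y = gen (V y) ^ h y by exact: pvertexE.
have adjC (y z : Y) : adj y z -> commute (alpha y) (alpha z) /\ alpha y <> alpha z.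
  case/commutation_adjP => yz cyz; apply: (pvertex_adj pP sV) => //.
  apply: tsim; [exact: valP|exact: valP|].
  by move/val_inj.
have exF (yz : seq_sub t * seq_sub t) : exists F : nat,
    ~ commute (P yz.1) (P yz.2) -> forall R g, F <= R ->
    big (V yz.1) R (h yz.1 * g) -> ~ big (V yz.2) R (h yz.2 * g).
  case: yz => y z /=; have [c|nc] := pselect (commute (P y) (P z)).
    by exists 0.
  have [|R0 HR] := @behrstock X (V y) (h y) (V z) (h z).
    by rewrite -!alphaE; apply: HM; rewrite ?mem_enum.
  by exists R0.
have [F HF] := choice exF.
(* Large enough for [behrstock] on all non-commuting pairs at once, and so large that no [h y] is
   big by itself. *)
pose R := (\max_yz F yz + \max_y cnt (V y) (h y))%N.
have FR yz : F yz <= R.+1.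
  by apply: leqW; apply: leq_trans (leq_addr _ _); exact: leq_bigmax.
have cR y : cnt (V y) (h y) < R.+1.
  by rewrite ltnS; apply: leq_trans (leq_addl _ _); exact: leq_bigmax.
have av y : ext_vertex_pred (alpha y).
  by apply/asboolP; exists (V y), (h y).
exists (fun y => exist _ (alpha y) (av y) : ext_vertex X), (2 * R.+1)%N; split=> //.
  move=> y z /adjC[c ne]; apply/andP; split; last exact/eqP.
  by apply/eqP => /(congr1 val).
move=> theta thM thE.
apply: (@pingpong X Y V h (fun=> 2 * R.+1)%N R theta thM) => //.
- by move=> y; rewrite thE /= alphaE.
- by move=> y z /adjC; rewrite !alphaE.
- move=> y z g yz nyz; apply: (HF (y, z)) => //=.
  move=> c; move/negP: nyz; apply; exact/commutation_adjP.
by move=> y; exact: nbig_cnt.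
Qed.

End Realisation.

(** * From an arbitrary embedding to one with clique supports *)

Lemma sim_commute (X : graph) (p p' q q' : raag X) : finite_set [set: X] ->
  pure p -> pure p' -> pure q -> pure q' -> commute p p' -> sim p q -> sim p' q' ->
  ~ sim q q' -> commute q q'.
Proof.
move=> finX [c [h pp]] [c' [h' pp']] [d [k pq]] _ cpp spq spq' nqq.
(* The pure elements are replaced one at a time by [pure_commute_sim], which needs the pair at hand
   not to be commensurable. *)
have npp : ~ sim p p'.
  move=> s; apply: nqq; apply: sim_trans (sim_sym spq) _; exact: sim_trans s spq'.
have cqp : commute q p' := pure_commute_sim finX pp pp' cpp npp (sim_sym spq).
apply/commute_sym; apply: (pure_commute_sim finX pp' pq) (sim_sym spq').
- exact: commute_sym.
- by move=> s; apply: nqq; apply: sim_trans (sim_sym s) spq'.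
Qed.

Lemma common_power (X : graph) (s t : seq (raag X)) :
  (forall p, p \in s -> exists2 q, q \in t & sim p q) ->
  exists2 K, 0 < K & forall p, p \in s -> exists q b n,
    [/\ q \in t, 0 < n, sim p q & p ^+ K = spow q b n].
Proof.
elim: s => [|p s IH] st; first by exists 1%N.
have [|K K0 HK] := IH; first by move=> q qs; apply: st; rewrite inE qs orbT.
have [q qt spq] := st p (mem_head _ _).
have [m [n [b [m0 n0 e]]]] := spq.
exists (m * K)%N; first by rewrite muln_gt0 m0.
move=> p'; rewrite inE => /orP[/eqP ->|/HK[q' [b' [n' [qt' n0' s' e']]]]].
  exists q, b, (n * K)%N; split=> //; first by rewrite muln_gt0 n0.
  by rewrite expgnA e spow_exp.
exists q', b', (n' * m)%N; split=> //; first by rewrite muln_gt0 n0'.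
by rewrite mulnC expgnA e' spow_exp.
Qed.

Lemma commute_prod2 (G : groupType) (I J : eqType) (r : seq I) (s : seq J)
    (E : I -> G) (F : J -> G) :
  (forall i j, i \in r -> j \in s -> commute (E i) (F j)) ->
  commute (\prod_(i <- r) E i) (\prod_(j <- s) F j).
Proof.
move=> H; rewrite big_seq [X in commute _ X]big_seq.
apply: (big_ind (fun g => commute g _)) => [|g h cg ch|i ir].
- exact/commute_sym/commute1.
- by apply/commute_sym/commuteM; exact: commute_sym.
by apply: (big_ind (commute (E i))) => *; [exact: commute1|exact: commuteM|exact: H].
Qed.

Lemma prod_exp (G : groupType) (s : seq G) K :
  (forall p q, p \in s -> q \in s -> commute p q) ->
  (\prod_(p <- s) p) ^+ K = \prod_(p <- s) p ^+ K.
Proof.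
elim: s => [|p s IH] cs; first by rewrite !big_nil expg1n.
rewrite !big_cons expgMn.
  by rewrite IH // => x y xs ys; apply: cs; rewrite inE ?xs ?ys orbT.
have := @commute_prod2 G G G [:: p] s id id; rewrite big_seq1; apply=> x y.
by rewrite inE => /eqP -> ys; apply: cs; rewrite inE ?eqxx ?ys ?orbT.
Qed.

Lemma inA_prod (X : graph) (S : X -> Prop) (I : eqType) (s : seq I) (E : I -> raag X) :
  (forall i, i \in s -> inA S (E i)) -> inA S (\prod_(i <- s) E i).
Proof.
elim: s => [|i s IH] H; rewrite ?big_nil ?big_cons; first exact: inA1.
apply: inAM; first by apply: H; rewrite mem_head.
by apply: IH => j js; apply: H; rewrite inE js orbT.
Qed.

Lemma inA_spow (X : graph) (S : X -> Prop) (g : raag X) b n :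
  inA S g -> inA S (spow g b n).
Proof. by move=> Sg; apply: inAX; case: b => //; exact: inAV. Qed.

(** Pure factors of the images of equal or adjacent vertices commute, so the vertices of [Y] that
    represent them are equal or adjacent; this yields the cliques. The statement covers adjacent
    pairs because the removal of inclusions needs it. *)
Lemma clique_embedding (L G : graph) (f : raag L -> raag G) :
  finite_graph L -> finite_graph G -> {morph f : g h / g * h} -> injective f ->
  exists psi : raag L -> raag (ext_graph G),
  [/\ {morph psi : g h / g * h}, injective (retraction (X := G) \o psi) &
      forall u u', u = u' \/ adj u u' ->
        clique (fun x => sup (psi (gen u)) x \/ sup (psi (gen u')) x)].
Proof.
move=> /finite_seqP[sL eL] finG fM finj.
have HsL u : u \in sL by have : [set: L]%classic u by []; rewrite eL.
have [ps Hps] := choice (fun u => pure_dec (f (gen u))).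
pose s := flatten [seq ps u | u <- sL].
have inps u p : p \in ps u -> p \in s.
  by move=> pu; apply/flatten_mapP; exists u.
have spure p : p \in s -> pure p.
  by case/flatten_mapP => u _; case: (Hps u) => H _ _; exact: H.
have [t [ts st tt]] := representatives s (@sim_refl (raag G)) (@sim_sym (raag G)).
have tpure p : p \in t -> pure p by move/ts/spure.
have [K K0 HK] := common_power st.
pose Y := commutation_graph t.
have [a [N [N0 aadj ainj]]] := realisation finG tpure tt.
have exE p : exists E : raag Y, p \in s -> exists (y : Y) b n,
    [/\ sim p (val (y : seq_sub t)), E = spow (gen y) b n &
        p ^+ K = spow (val (y : seq_sub t)) b n].
  have [ps'|nps] := pselect (p \in s); last by exists 1.
  have [q [b [n [qt n0 spq e]]]] := HK p ps'.
  by exists (spow (gen (SeqSub qt : Y)) b n) => _; exists (SeqSub qt), b, n.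
have [E HE] := choice exE.
have pcomm u u' p p' : u = u' \/ adj u u' -> p \in ps u -> p' \in ps u' -> commute p p'.
  move=> uu pu pu'; have [_ H _] := Hps u; have [_ H' _] := Hps u'.
  apply/commute_sym/H => //; apply/commute_sym/H' => //.
  case: uu => [->|uu]; first exact: commute_refl.
  by rewrite /commute -!fM (gen_commute uu).
have ycomm u u' p p' (y y' : Y) : u = u' \/ adj u u' -> p \in ps u -> p' \in ps u' ->
    sim p (val (y : seq_sub t)) -> sim p' (val (y' : seq_sub t)) -> y = y' \/ adj y y'.
  move=> uu pu pu' sy sy'; have [->|/eqP ne] := eqVneq y y'; [by left|right].
  apply/commutation_adjP; split=> //.
  apply: (@sim_commute G p p') sy sy' _ => //.
  - exact: spure (inps _ _ pu).
  - exact: spure (inps _ _ pu').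
  - exact: tpure (valP (y : seq_sub t)).
  - exact: tpure (valP (y' : seq_sub t)).
  - exact: pcomm uu pu pu'.
  - apply: tt; [exact: (valP (y : seq_sub t))|exact: (valP (y' : seq_sub t))|].
    by move/val_inj.
pose Psi u := \prod_(p <- ps u) E p.
have PsiC u u' : adj u u' -> commute (Psi u) (Psi u').
  move=> uu; apply: commute_prod2 => p p' pu pu'.
  have [y [b [n [sy -> _]]]] := HE p (inps _ _ pu).
  have [y' [b' [n' [sy' -> _]]]] := HE p' (inps _ _ pu').
  apply/commute_spow/commute_sym/commute_spow.
  have [->|yy] := ycomm _ _ _ _ _ _ (or_intror uu) pu pu' sy sy'.
    exact: commute_refl.
  by apply/commute_sym/gen_commute.
pose PsiL := raag_lift Psi.
have PsiG u : PsiL (gen u) = Psi u := raag_lift_gen PsiC u.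
have PsiM : {morph PsiL : g h / g * h} := raag_liftM PsiC.
pose chi : raag Y -> raag G := raag_lift (fun y : Y => val (y : seq_sub t)).
have chiC (y y' : Y) : adj y y' -> commute (val (y : seq_sub t)) (val (y' : seq_sub t)).
  by case/commutation_adjP.
have chiG y : chi (gen y) = val (y : seq_sub t) := raag_lift_gen chiC y.
have chiM : {morph chi : g h / g * h} := raag_liftM chiC.
(* The exponent [K] turns every pure factor into a signed power of its representative, so [PsiL]
   lifts an injective map through [chi]. *)
have ePsi : chi \o PsiL =1 f \o pow_map (fun=> K).
  apply: hom_ext => [g h|g h|u] /=; rewrite ?PsiM ?chiM ?pow_mapM ?fM //.
  rewrite pow_map_gen (homX fM) PsiG (hom_prod chiM).
  have [_ _ ->] := Hps u; rewrite prod_exp => [|p q pu qu]; last first.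
    by apply: pcomm pu qu; left.
  apply: eq_big_seq => p /inps/HE[y [b [n [_ -> ->]]]].
  by rewrite (hom_spow chiM) chiG.
have Psi_inj : injective PsiL.
  apply: (@inj_compr _ _ _ chi); apply: (eq_inj _ (fsym ePsi)).
  exact: inj_comp finj (pow_map_inj (fun=> K0)).
pose kappa : raag Y -> raag (ext_graph G) := raag_lift (fun y => gen (a y) ^+ N).
have kappaC (y z : Y) : adj y z -> commute (gen (a y) ^+ N) (gen (a z) ^+ N).
  by move=> /aadj yz; apply/commuteX2/gen_commute.
have kappaG y : kappa (gen y) = gen (a y) ^+ N := raag_lift_gen kappaC y.
have kappaM : {morph kappa : g h / g * h} := raag_liftM kappaC.
exists (kappa \o PsiL); split.
- by move=> g h /=; rewrite PsiM kappaM.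
- apply: (@inj_comp _ _ _ (retraction (X := G) \o kappa) PsiL) => //.
  apply: ainj => [g h|y] /=; first by rewrite kappaM retractionM.
  by rewrite kappaG (homX (@retractionM G)) retraction_gen.
move=> u u' uu; pose S u0 x := exists p y, [/\ p \in ps u0,
   sim p (val (y : seq_sub t)) & x = a y].
have Ssup u0 x : sup ((kappa \o PsiL) (gen u0)) x -> S u0 x.
  move: x; rewrite -/(inA (S u0) _) /= PsiG (hom_prod kappaM).
  apply: inA_prod => p pu; have [y [b [n [sy -> _]]]] := HE p (inps _ _ pu).
  rewrite (hom_spow kappaM) kappaG.
  by apply: inA_spow; apply: inAX; apply/inA_gl; exists p, y.
have key u1 u2 x x' : u1 = u2 \/ adj u1 u2 -> S u1 x -> S u2 x' -> x <> x' -> adj x x'.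
  move=> u12 [p [y [pu sy ->]]] [p' [y' [pu' sy' ->]]] ne; apply: aadj.
  by have [ey|//] := ycomm _ _ _ _ _ _ u12 pu pu' sy sy'; case: ne; rewrite ey.
have u'u : u' = u \/ adj u' u by case: uu => [->|]; [left|rewrite adj_sym; right].
have SS x : sup ((kappa \o PsiL) (gen u)) x \/ sup ((kappa \o PsiL) (gen u')) x ->
    S u x \/ S u' x by case=> /Ssup; [left|right].
move=> x x' /SS Sx /SS Sx' ne; case: Sx Sx' => Sx [] Sx'.
- by apply: key Sx Sx' ne; left.
- exact: key Sx Sx' ne.
- exact: key Sx Sx' ne.
by apply: key Sx Sx' ne; left.
Qed.

(** * Removing inclusions between cliques *)

Section Transvection.
Variables (X : graph) (v w : X).
Hypothesis vw : v <> w.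
Hypothesis vwC : forall u, adj u w -> commute (gen u) (gen v).

Definition trans_gen m b n (u : X) : raag X :=
  if u == w then gen w ^+ m * spow (gen v) b n else gen u.

Lemma trans_genC m b n x y :
  adj x y -> commute (trans_gen m b n x) (trans_gen m b n y).
Proof.
have key u : adj u w -> commute (gen u) (gen w ^+ m * spow (gen v) b n).
  move=> uw; apply: commuteM; first exact/commuteX/gen_commute.
  exact/commute_spow/vwC.
rewrite /trans_gen => xy; case: eqVneq => [xw|_]; case: eqVneq => [yw|_].
- exact: commute_refl.
- by apply/commute_sym/key; rewrite -xw adj_sym.
- by apply: key; rewrite -yw.
exact: gen_commute.
Qed.

Definition trans m b n : raag X -> raag X := raag_lift (trans_gen m b n).

Lemma transM m b n : {morph trans m b n : g h / g * h}.
Proof. exact: (raag_liftM (@trans_genC m b n)). Qed.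

Lemma trans_gen_w m b n : trans m b n (gen w) = gen w ^+ m * spow (gen v) b n.
Proof. by rewrite /trans (raag_lift_gen (@trans_genC m b n)) /trans_gen eqxx. Qed.

Lemma trans_gen_neq m b n u : u <> w -> trans m b n (gen u) = gen u.
Proof.
by move=> uw; rewrite /trans (raag_lift_gen (@trans_genC m b n)) /trans_gen;
   case: eqVneq.
Qed.

(** The map is a transvection, inverted by flipping the sign of [v], followed by the injective map
    that raises [w] to the power [m]. *)
Lemma trans_inj m b n : 0 < m -> injective (trans m b n).
Proof.
move=> m0; pose N u := if u == w then m else 1%N.
have e : trans m b n =1 pow_map N \o trans 1 b n.
  apply: hom_ext => [g h|g h|u] /=; rewrite ?transM ?pow_mapM //.
  have [->|/eqP uw] := eqVneq u w.
    rewrite !trans_gen_w pow_mapM (hom_spow (pow_mapM N)) !pow_map_gen /N eqxx.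
    by rewrite ifF //; exact/eqP.
  by rewrite !trans_gen_neq // pow_map_gen /N ifF //; exact/eqP.
have e1 : cancel (trans 1 b n) (trans 1 (~~ b) n).
  move=> g; rewrite -[LHS]/((trans 1 (~~ b) n \o trans 1 b n) g) -[RHS]/(id g).
  apply: hom_ext g => [g h|//|u] /=; rewrite ?transM //.
  have [->|/eqP uw] := eqVneq u w; last by rewrite !trans_gen_neq.
  rewrite trans_gen_w transM (hom_spow (transM _ _ _)) (homX (transM _ _ _)).
  rewrite trans_gen_w trans_gen_neq // !expg1 -mulgA !spowE.
  by case: (b); rewrite /= ?mulgV ?mulVg mulg1.
apply: (eq_inj _ (fsym e)); apply: inj_comp; last exact: can_inj e1.
by apply: pow_map_inj => u; rewrite /N; case: ifP.
Qed.

End Transvection.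

Section Kill.
Variable X : graph.
Implicit Types (g h : raag X) (K : X -> Prop).

Lemma clique_split K g a : clique K -> inA K g -> K a ->
  exists b n t, g = gl (a, b) ^+ n * t /\ inA (fun x => K x /\ x <> a) t.
Proof.
move=> cK Kg Ka.
have [||s [t [-> Ss St]]] := inA_split (S := fun x => x = a) (T := fun x => K x /\ x <> a) (g := g).
- by move=> x y -> [Ky ya]; apply: cK => // /esym.
- by move=> x /Kg Kx; have [|] := pselect (x = a); [left|right].
by have [b [n ->]] := inA_pow Ss; exists b, n, t.
Qed.

(** Over a clique everything commutes, so exponents add up. With exponents [m] and [n] of [a] in [g]
    and [h], raising [h] to [m] and [g] to [n] makes them equal, and the sign [b == b'] makes them
    cancel. *)
Lemma kill_vertex K g h a : clique K -> inA K g -> inA K h -> sup g a ->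
  exists m b n, 0 < m /\ inA (fun x => K x /\ x <> a) (h ^+ m * spow g b n).
Proof.
move=> cK Kg Kh ga; have Ka := Kg _ ga.
have [b [m [t [eg St]]]] := clique_split cK Kg Ka.
have [b' [n [t' [eh St']]]] := clique_split cK Kh Ka.
have m0 : 0 < m.
  rewrite lt0n; apply/eqP => m0; have [|_] := St a; last exact.
  by move: ga; rewrite eg m0 mul1g.
exists m, (b == b'), n; split=> //.
pose K' x := K x /\ x <> a.
have KK' k : inA K' k -> inA K k by apply: inA_sub => x [].
have Kx c : inA K (gl (a, c)) by exact/inA_gl.
have cx c k j : inA K' k -> commute (gl (a, c) ^+ j) k.
  move=> /KK' Kk; apply: (commute_clique cK) => //; exact: inAX.
have e1 : spow g (b == b') n = spow (gl (a, b)) (b == b') (m * n) * spow t (b == b') n.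
  rewrite !spowE eg (expgMn _ (cx _ _ _ St)) -expgnA; case: ifP => // _.
  rewrite invgM; apply: (commute_clique cK).
    by apply: inAV; apply: inAX; exact: KK'.
  by apply: inAV; apply: inAX.
have e2 : gl (a, b') ^+ (n * m) * spow (gl (a, b)) (b == b') (m * n) = 1.
  rewrite spowE mulnC; case: eqVneq => [->|nb]; first by rewrite mulgV.
  have -> : (a, b') = linv (a, b) by rewrite /linv /=; case: b b' nb {eg eh e1} => [] [].
  by rewrite -glV expVgn mulVg.
have -> : h ^+ m * spow g (b == b') n = t' ^+ m * spow t (b == b') n.
  rewrite eh (expgMn _ (cx _ _ _ St')) -expgnA e1.
  rewrite (cx b' (t' ^+ m) (n * m)%N) ?mulgA; last exact: inAX.
  by rewrite -(mulgA (t' ^+ m)) e2 mulg1.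
by apply: inAM; [exact: inAX|exact: inA_spow].
Qed.

Definition supp_size g := size (undup [seq l.1 | l <- nfg g]).

Lemma mem_supp_size g x : (x \in undup [seq l.1 | l <- nfg g]) <-> sup g x.
Proof.
rewrite mem_undup /sup /cnt -has_count; split=> [/mapP[l lg ->]|/hasP[l lg /= /eqP <-]].
  by apply/hasP; exists l => /=.
exact: map_f.
Qed.

Lemma supp_size_lt g h a : (forall x, sup g x -> sup h x /\ x <> a) -> sup h a ->
  supp_size g < supp_size h.
Proof.
move=> gh ha; pose s := undup [seq l.1 | l <- nfg g].
rewrite /supp_size -/s -[_.+1]/(size (a :: s)); apply: uniq_leq_size.
  rewrite /= undup_uniq andbT; apply/negP => /mem_supp_size/gh[_].
  exact.
move=> x; rewrite inE => /orP[/eqP ->|/mem_supp_size/gh[hx _]]; exact/mem_supp_size.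
Qed.

End Kill.

Lemma sum_lt (I : eqType) (s : seq I) (E F : I -> nat) i : i \in s ->
  (forall j, E j <= F j) -> E i < F i ->
  \sum_(j <- s) E j < \sum_(j <- s) F j.
Proof.
move=> + le lt; elim: s => // j s IH; rewrite inE !big_cons => /orP[/eqP <-|/IH lts].
  by rewrite -addSn leq_add // leq_sum.
by rewrite -addnS leq_add.
Qed.

(** Induction on the total support size. If the clique of [v] lies in that of [w], then for [u]
    adjacent to [w] the images of [u] and [v] lie over one clique, so [u] and [v] commute and the
    transvection is defined. It removes [a] from the clique of [w] and enlarges no other, so the
    hypothesis on adjacent pairs persists. *)
Lemma incomparable_cliques (L G : graph) (psi : raag L -> raag (ext_graph G)) :
  finite_graph L -> {morph psi : g h / g * h} ->
  injective (retraction (X := G) \o psi) ->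
  (forall u u', u = u' \/ adj u u' ->
    clique (fun x => sup (psi (gen u)) x \/ sup (psi (gen u')) x)) ->
  exists psi' : raag L -> raag (ext_graph G),
  [/\ {morph psi' : g h / g * h}, injective (retraction (X := G) \o psi'),
      forall u, clique (sup (psi' (gen u))) &
      forall u u', u <> u' -> ~ (forall x, sup (psi' (gen u)) x -> sup (psi' (gen u')) x)].
Proof.
case/finite_seqP => sL eL.
have HsL u : u \in sL by have : [set: L]%classic u by []; rewrite eL.
have [n] := ubnP (\sum_(u <- sL) supp_size (psi (gen u))).
elim: n psi => // n IH psi ltn psiM psiI psiC.
have cl u : clique (sup (psi (gen u))).
  by move=> x y ux uy; apply: (psiC u u (or_introl erefl)); left.
have [[v [w [vw sub]]]|H] := pselect (exists v w, v <> w /\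
    forall x, sup (psi (gen v)) x -> sup (psi (gen w)) x); last first.
  exists psi; split=> // u u' uu sub; apply: H; by exists u, u'.
have psi_inj : injective psi.
  by move=> g h e; apply: psiI; rewrite /= e.
have [a va] : exists a, sup (psi (gen v)) a.
  have [|[a b] /starts_cnt sa] := @starts_neq1 _ (psi (gen v)); last by exists a.
  by rewrite -(hom1 psiM) => /psi_inj/gen_neq1.
have [m [b [k [m0 kill]]]] := kill_vertex (cl w) sub (@inA_sup _ _) va.
have vwC u : adj u w -> commute (gen u) (gen v).
  move=> uw; apply: psi_inj; rewrite !psiM.
  apply: (commute_clique (psiC u w (or_intror uw))) => x xx; first by left.
  by right; exact: sub.
pose T := trans v w m b k.
have ew : psi (T (gen w)) = psi (gen w) ^+ m * spow (psi (gen v)) b k.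
  by rewrite /T trans_gen_w // psiM (homX psiM) (hom_spow psiM).
have en u : u <> w -> psi (T (gen u)) = psi (gen u).
  by move=> uw; rewrite /T trans_gen_neq.
have subT u x : sup (psi (T (gen u))) x -> sup (psi (gen u)) x.
  have [->|/eqP uw] := eqVneq u w; last by rewrite en.
  by rewrite ew => /kill[].
apply: (IH (psi \o T)) => /=.
- rewrite -ltnS; apply: leq_trans ltn; rewrite ltnS.
  apply: (sum_lt (i := w)) => //= [u|].
    have [->|/eqP uw] := eqVneq u w; last by rewrite en.
    apply/ltnW/(supp_size_lt (a := a)); last exact: sub.
    by move=> x; rewrite ew => /kill.
  apply: (supp_size_lt (a := a)); last exact: sub.
  by move=> x; rewrite ew => /kill.
- by move=> g h /=; rewrite /T transM // psiM.
- apply: (@inj_comp _ _ _ (retraction (X := G) \o psi) T) => //.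
  exact: trans_inj.
move=> u u' uu x y xx yy; apply: (psiC u u' uu).
  by case: xx => /subT; [left|right].
by case: yy => /subT; [left|right].
Qed.

Theorem theorem35 (L G : graph)
    (finL : finite_graph L) (finG : finite_graph G)
    (embLG : exists f : {multiplicative raag L -> raag G}, injective f) :
  (exists psi : {multiplicative raag L -> raag (ext_graph G)},
      injective (retraction (X := G) \o psi) /\
      (forall v : L, clique (supp (psi (gen v)))))
  /\
  (exists psi : {multiplicative raag L -> raag (ext_graph G)},
      [/\ injective (retraction (X := G) \o psi),
          (forall v : L, clique (supp (psi (gen v)))) &
          (forall v w : L, v <> w ->
             ~ (supp (psi (gen v)) `<=` supp (psi (gen w)))%classic)]).
Proof.
have [f finj] := embLG.
have [psi0 [M0 I0 C0]] := clique_embedding finL finG (@gmulfM _ _ f) finj.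
have [psi [psiM psiI psiC psiN]] := incomparable_cliques finL M0 I0 C0.
pose psi_hom := HB.pack_for {multiplicative raag L -> raag (ext_graph G)} psi
  (isMultiplicative.Build _ _ psi psiM).
(* The homomorphism with incomparable cliques serves for both parts. *)
split; exists psi_hom; split=> //; try by move=> v; rewrite supp_sup; exact: psiC.
by move=> v w vw; rewrite !supp_sup => sub; exact: psiN vw sub.
Qed.
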